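(* Let $u\in U$ be non-isotropic, i.e. $\beta(u,u)\neq0$, and let $U'=u^\perp$ (with the restricted form). There is a one-to-one correspondence between (1) representation spaces (invariant subspaces) of the symplectic group $\mathrm{Sp}(V)$ acting via $\mu_{U'\otimes V}$ on $L^2(\mathrm{Hom}(X\to U'))$, and (2) representation spaces (invariant subspaces) of the Jacobi group over $V$ acting via $\mathcal{C}l^{(u)}_{U\otimes V}$ on $L^2(\mathrm{Hom}(X\to U))$. In particular, if $t\geq2$ and $p$ does not divide $t$, there is a one-to-one correspondence between irreducible subrepresentations of the $\mathrm{Sp}(V)$-representation $\mu_V^{\otimes(t-2)}\otimes\mu_V^{(t)}$ and irreducible subrepresentations of the representation $\mathcal{C}l_V^{\otimes t}$ of the Jacobi group over $V$.
   Context: Notation. $q$ is a power of an odd prime $p$. For $\lambda\in\mathbb{F}_q^\times$, $\ell_\lambda=+1$ if $\lambda$ is a square and $-1$ otherwise. For $m\in\mathbb{F}_q^\times$, $\omega^{(m)}(\lambda)=\exp\big(\tfrac{2\pi i}{p}\mathrm{Tr}(m\lambda)\big)$ with $\mathrm{Tr}:\mathbb{F}_q\to\mathbb{F}_p$ the field trace. For a finite set $S$, $L^2(S)$ is the Hilbert space of complex functions on $S$, and $\delta_s$ is the indicator function of $s\in S$. The transpose of a linear map $A$ is $A^t$. A map $A:Y^*\to Y$ is symmetric if $A=A^t$; one writes $A(y,y')=y'(Ay)$. Oscillator representation. For a finite-dimensional $\mathbb{F}_q$-space $Y$, $Y\oplus Y^*$ carries the symplectic form $[x\oplus y,x'\oplus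 y']=y'(x)-y(x')$. The oscillator representation of mass $m$, $\mu^{(m)}_{Y\oplus Y^*}$, of $\mathrm{Sp}(Y\oplus Y^* )$ on $L^2(Y^* )$ is the representation determined on generators by $\mu(N_A)\delta_y=\omega^{(m)}(2^{-1}A(y,y))\,\delta_y$, $\ \mu(D_C)\delta_y=\ell_{\det C}\,\delta_{C^{-t}y}$, $\ \mu(J_B)\delta_y=\gamma(B)^{-1}\sum_{y'\in Y^*}\omega^{(m)}(B(y,y'))\,\delta_{y'}$, where $N_A=\begin{pmatrix}1&A\\0&1\end{pmatrix}$ ($A:Y^*\to Y$ symmetric), $D_C=\begin{pmatrix}C&0\\0&C^{-t}\end{pmatrix}$ ($C\in GL(Y)$), $J_B=\begin{pmatrix}0&B\\-B^{-1}&0\end{pmatrix}$ ($B:Y^*\to Y$ symmetric invertible), and $\gamma(B)=\sum_{y\in Y^*}\omega^{(m)}(-2^{-1}B(y,y))$. Heisenberg and Jacobi group. For a symplectic space $V=X\oplus X^*$, the Heisenberg group $H(V)$ is $\mathbb{F}_q\times V$ with $(\lambda,v)\circ(\lambda',v')=(\lambda+\lambda'+2^{-1}[v,v'],v+v')$. Its Weyl representation of mass $m$ on $L^2(X^* )$ is $W_V^{(m)}(\lambda,x\oplus y)\delta_z=\omega^{(m)}(2^{-1}y(x)+z(x)+\lambda)\,\delta_{z+y}$. The Jacobi group over $V$ is the semidirect product $H(V)\rtimes\mathrm{Sp}(V)$ with $S(\lambda,v)S^{-1}=(\lambda,Sv)$. It is represented on $L^2(X^* )$ by $\mathcal{C}l_V^{(m)}(\lambda,v,S)=W_V^{(m)}(\lambda,v)\,\mu_V^{(m)}(S)$.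 The superscript is omitted for $m=1$. An integer $t$ not divisible by $p$ is regarded as an element of $\mathbb{F}_q^\times$ when used as a mass. Setting. $X$ is an $n$-dimensional $\mathbb{F}_q$-space and $V=X\oplus X^*$. $U$ is a finite-dimensional $\mathbb{F}_q$-space with a non-degenerate symmetric bilinear form $\beta$. For any such orthogonal space $U$ (also for $U'$), $U\otimes V=(U\otimes X)\oplus(U\otimes X^* )$ is symplectic, the two summands being dual via $\langle u\otimes x,v\otimes y\rangle=\beta(u,v)y(x)$; identifying $U\otimes X^*=\mathrm{Hom}(X\to U)$, the representations $\mu_{U\otimes V}$ and $W_{U\otimes V}$ (mass $1$) act on $L^2(\mathrm{Hom}(X\to U))$. For $S\in\mathrm{Sp}(V)$, $\mu_{U\otimes V}(S)$ means $\mu_{U\otimes V}(\mathrm{Id}_U\otimes S)$. For $u\in U$, $\iota_u:H(V)\to H(U\otimes V)$ is the homomorphism $\iota_u(\lambda,v)=(\beta(u,u)\lambda,u\otimes v)$, and $\mathcal{C}l^{(u)}_{U\otimes V}(\lambda,v,S)=W_{U\otimes V}(\iota_u(\lambda,v))\,\mu_{U\otimes V}(S)$ is a representation of the Jacobi group over $V$ on $L^2(\mathrm{Hom}(X\to U))$. *)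

(* Defs.v *)
From HB Require Import structures.
From mathcomp Require Import all_boot all_order all_algebra all_fingroup all_field.
From mathcomp Require Import complex.
From mathcomp Require Import boolp classical_sets functions reals trigo.

Set Implicit Arguments.
Unset Strict Implicit.
Unset Printing Implicit Defensive.

Import Order.TTheory GRing.Theory Num.Theory.
Local Open Scope classical_set_scope.
Local Open Scope ring_scope.

(* Functions S -> C; the inner product plays no role in what follows. *)
Definition L2 (R : realType) (S : finType) := {ffun S -> R[i]^o}.

Section Operators.
Variable R : realType.

Definition delta (S : finType) (s : S) : L2 R S := [ffun s' => (s' == s)%:R].

(* The operator sending delta s to phi s. *)
Definition op_of (S T : finType) (phi : S -> L2 R T) : 'Hom(L2 R S, L2 R T) :=
  linfun (fun f : L2 R S => \sum_(s : S) (f s : R[i]) *: phi s).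

Lemma op_ofE (S T : finType) (phi : S -> L2 R T) s : op_of phi (delta s) = phi s.
Proof.
pose g (f : L2 R S) := \sum_(s : S) (f s : R[i]) *: phi s.
have lg : linear g.
  move=> a x y; rewrite /g scaler_sumr -big_split; apply: eq_bigr => i _ /=.
  by rewrite ffunE ffunE scalerDl scalerA.
pose gL := GRing.isLinear.Build _ _ _ _ g lg.
pose G : {linear L2 R S -> L2 R T} := HB.pack g gL.
rewrite /op_of (lfunE G) /= /g (bigD1 s) //= ffunE eqxx scale1r big1 ?addr0 //.
by move=> i /negPf si; rewrite ffunE si scale0r.
Qed.

(* L2 (S * T) is the tensor product of L2 S and L2 T, with
   delta (s, t) = delta s (x) delta t; likewise L2 {ffun 'I_k -> S} is the
   k-th tensor power of L2 S. *)
Definition tens_op (S T : finType) (A : 'End(L2 R S)) (B : 'End(L2 R T)) :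
    'End(L2 R (S * T)%type) :=
  op_of (fun st => [ffun w : S * T =>
    (A (delta st.1) w.1 * B (delta st.2) w.2 : R[i])]).

Definition tpow_op (S : finType) (k : nat) (A : 'End(L2 R S)) :
    'End(L2 R {ffun 'I_k -> S}) :=
  op_of (fun s : {ffun 'I_k -> S} => [ffun w : {ffun 'I_k -> S} =>
    (\prod_(i < k) (A (delta (s i)) (w i) : R[i]) : R[i])]).

End Operators.

(* A representation is given as a family rho of operators indexed by the
   elements of G lying in D.  The group law of D is not recorded: none of the
   notions below depends on it. *)
Section Subrepresentations.
Variables (R : realType) (S : finType) (G : Type) (D : set G).
Variable rho : G -> 'End(L2 R S).

Definition invariant_sub (K : {vspace L2 R S}) : Prop :=
  forall g, D g -> (rho g @: K <= K)%VS.

Definition irreducible_sub (K : {vspace L2 R S}) : Prop :=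
  [/\ invariant_sub K, K != 0%VS &
      forall K', invariant_sub K' -> (K' <= K)%VS -> K' = 0%VS \/ K' = K].

Definition rep_iso (K K' : {vspace L2 R S}) : Prop :=
  exists T : 'End(L2 R S),
    [/\ (T @: K = K')%VS, (K :&: lker T = 0)%VS &
        forall g, D g -> {in K, forall f, T (rho g f) = rho g (T f)}].

End Subrepresentations.

(* A one-to-one correspondence between two families of subrepresentations is a
   bijection compatible with inclusion and with isomorphism. *)
Definition correspondence (R : realType) (S1 S2 : finType)
    (P1 : {vspace L2 R S1} -> Prop) (iso1 : {vspace L2 R S1} -> _ -> Prop)
    (P2 : {vspace L2 R S2} -> Prop) (iso2 : {vspace L2 R S2} -> _ -> Prop) :=
  exists Phi : {vspace L2 R S1} -> {vspace L2 R S2},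
    [/\ set_bij [set K | P1 K] [set K | P2 K] Phi,
        forall K K', P1 K -> P1 K' -> (Phi K <= Phi K')%VS = (K <= K')%VS &
        forall K K', P1 K -> P1 K' -> (iso2 (Phi K) (Phi K') <-> iso1 K K')].

Section Characters.
Variables (R : realType) (F : finFieldType) (p : nat) (pF : p \in [pchar F]).

(* galTrace takes its values in the prime field, seen inside F. *)
Definition field_trace (x : F) : 'F_p :=
  odflt 0 [pick a : 'F_p |
    a%:A == galTrace 1%AS {: pPrimeCharType pF} x :> pPrimeCharType pF].

Definition omega (m x : F) : R[i] :=
  let theta := 2 * pi * (field_trace (m * x))%:R / p%:R in
  (cos theta +i* sin theta)%C.

Definition legendre (x : F) : R[i] := if [exists y, x == y ^+ 2] then 1 else -1.

End Characters.

Definition lfun_det (F : fieldType) (Y : vectType F) (C : 'End(Y)) : F :=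
  \det (passmx.mxof (vbasis {:Y}) (vbasis {:Y}) C).

(* The dual Y^* of Y is presented as any space Z together with a perfect
   pairing br : Z -> Y -> F, br z y standing for z(y). *)
Section Oscillator.
Variables (R : realType) (F : finFieldType) (p : nat) (pF : p \in [pchar F]).
Variables (Y Z : vectType F) (br : Z -> Y -> F).

Local Notation V := (Y * Z)%type.
Local Notation omega := (omega R pF).
Local Notation L2Z := (L2 R (finvect_type Z)).
Local Notation delta := (@delta R (finvect_type Z)).

Definition symp_form (v w : V) : F := br w.2 v.1 - br v.2 w.1.

Definition Sp : set 'End(V) :=
  [set S | forall v w, symp_form (S v) (S w) = symp_form v w].

(* A(y, y') = y'(A y) *)
Definition lbil (A : 'Hom(Z, Y)) (y y' : Z) : F := br y' (A y).
Definition lsym (A : 'Hom(Z, Y)) : Prop := forall y y', lbil A y y' = lbil A y' y.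

Definition opN (A : 'Hom(Z, Y)) : 'End(V) :=
  linfun (fun v : V => (v.1 + A v.2, v.2)).
Definition opD (C : 'End(Y)) (C' : 'End(Z)) : 'End(V) :=
  linfun (fun v : V => (C v.1, C' v.2)).
Definition opJ (B : 'Hom(Z, Y)) : 'End(V) :=
  linfun (fun v : V => (B v.2, - (B^-1)%VF v.1)).

Definition gamma (m : F) (B : 'Hom(Z, Y)) : R[i] :=
  \sum_(y : finvect_type Z) omega m (- 2^-1 * lbil B y y).

(* mu restricted to Sp is the oscillator representation of mass m on L2(Z): the
   unique representation with these values on generators (its values outside Sp
   are junk).  In the opD clause, C' is the inverse transpose of C. *)
Definition is_oscillator (m : F) (mu : 'End(V) -> 'End(L2Z)) : Prop :=
  [/\ mu \1%VF = \1%VF /\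
        (forall S T, Sp S -> Sp T -> mu (S \o T)%VF = (mu S \o mu T)%VF),
      forall A, lsym A -> forall y : Z,
        mu (opN A) (delta y) = omega m (2^-1 * lbil A y y) *: delta y,
      forall (C : 'End(Y)) (C' : 'End(Z)), lker C = 0%VS ->
        (forall z y, br (C' z) (C y) = br z y) -> forall y : Z,
        mu (opD C C') (delta y) = legendre R (lfun_det C) *: delta (C' y) &
      forall B, lsym B -> lker B = 0%VS -> limg B = fullv -> forall y : Z,
        mu (opJ B) (delta y) = (gamma m B)^-1 *:
          \sum_(y' : finvect_type Z) omega m (lbil B y y') *: delta y'].

(* The Weyl representation of mass m of H(Y + Z) = F * (Y + Z). *)
Definition weyl (m : F) (h : F * V) : 'End(L2Z) :=
  op_of (fun z : finvect_type Z =>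
    omega m (2^-1 * br h.2.2 h.2.1 + br z h.2.1 + h.1) *: delta (z + h.2.2)).

(* The Jacobi group H(Y + Z) x| Sp(Y + Z), with elements (lambda, v, S). *)
Definition Jacobi : set (F * V * 'End(V)) := [set g | Sp g.2].

Definition clifford (m : F) (mu : 'End(V) -> 'End(L2Z)) (g : F * V * 'End(V)) :
    'End(L2Z) := (weyl m g.1 \o mu g.2)%VF.

End Oscillator.

Section Dual.
Variables (F : finFieldType) (X : vectType F).

Definition dualv := 'Hom(X, F^o).

Definition ev (y : dualv) (x : X) : F := (y : 'Hom(X, F^o)) x.

Definition dual_basis (j : 'I_(\dim {:X})) : dualv :=
  linfun (coord (vbasis {:X}) j : X -> F^o).

End Dual.

(* For V = X + X^*, the space U (x) V is modelled as the product of
   U (x) X = Hom(X^* -> U) and U (x) X^* = Hom(X -> U). *)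
Section Tensor.
Variables (F : finFieldType) (U X : vectType F).

Local Notation V := (X * dualv X)%type.
Local Notation UX := 'Hom(dualv X, U).
Local Notation UXd := 'Hom(X, U).
Local Notation UV := (UX * UXd)%type.

Definition tens (u : U) (v : V) : UV :=
  (linfun (fun y : dualv X => ev y v.1 *: u), linfun (fun x : X => ev v.2 x *: u)).

(* The pairing with <u (x) x, v (x) y> = beta u v * y(x), see tens_brE. *)
Definition tens_br (beta : U -> U -> F) (b : UXd) (a : UX) : F :=
  \sum_j beta (a (dual_basis j)) (b (vbasis {:X})`_j).

(* Id_U (x) S, expanded in a basis of X; see id_tensE. *)
Definition id_tens (S : 'End(V)) : 'End(UV) :=
  linfun (fun w : UV => \sum_j
    (tens (w.1 (dual_basis j)) (S ((vbasis {:X})`_j, 0)) +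
     tens (w.2 (vbasis {:X})`_j) (S (0, dual_basis j)))).

Lemma tensE1 u v (y : dualv X) : (tens u v).1 y = ev y v.1 *: u.
Proof.
pose g (y : dualv X) := ev y v.1 *: u.
have lg : linear g.
  by move=> a y1 y2; rewrite /g /ev lfunE /= lfunE /= scalerDl scalerA.
pose G : {linear dualv X -> U} := HB.pack g (GRing.isLinear.Build _ _ _ _ g lg).
by rewrite /tens /= (lfunE G).
Qed.

Lemma tensE2 u v (x : X) : (tens u v).2 x = ev v.2 x *: u.
Proof.
pose g (x : X) := ev v.2 x *: u.
have lg : linear g.
  by move=> a x1 x2; rewrite /g /ev linearP /= scalerDl scalerA.
pose G : {linear X -> U} := HB.pack g (GRing.isLinear.Build _ _ _ _ g lg).
by rewrite /tens /= (lfunE G).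
Qed.

Lemma dual_basis_sum (y : dualv X) (x : X) :
  \sum_j ev (dual_basis j) x * ev y (vbasis {:X})`_j = ev y x.
Proof.
rewrite [in RHS](coord_vbasis (memvf x)) /ev linear_sum /=.
by apply: eq_bigr => j _; rewrite linearZ /= /dual_basis lfunE.
Qed.

Lemma tens_brE (beta : {symmetric U}) u v (x : X) (y : dualv X) :
  tens_br beta (tens v (0, y)).2 (tens u (x, 0)).1 = beta u v * ev y x.
Proof.
rewrite -(dual_basis_sum y x) mulr_sumr; apply: eq_bigr => j _.
by rewrite tensE1 tensE2 linearZl_LR linearZr_LR /= mulrA [RHS]mulrC.
Qed.

Lemma tens_is_bilinear : bilinear_for *:%R *:%R tens.
Proof.
split=> [v a u w|u a v w]; congr (_, _); apply/lfunP => z.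
- by rewrite !(tensE1 _ v) !lfunE /= !lfunE /= !tensE1 scalerDr !scalerA mulrC.
- by rewrite !(tensE2 _ v) !lfunE /= !lfunE /= !tensE2 scalerDr !scalerA mulrC.
- rewrite !(tensE1 u) !lfunE /= !lfunE /= !tensE1.
  by rewrite /ev /= linearP /= scalerDl scalerA.
rewrite !(tensE2 u) !lfunE /= !lfunE /= !tensE2.
by rewrite /ev /= !lfunE /= lfunE /= scalerDl scalerA.
Qed.

HB.instance Definition _ :=
  bilinear_isBilinear.Build F U V UV *:%R *:%R tens tens_is_bilinear.

Lemma dual_basis_sumV (v : V) :
  v = \sum_j (ev (dual_basis j) v.1 *: ((vbasis {:X})`_j, 0) +
              ev v.2 (vbasis {:X})`_j *: (0, dual_basis j)).
Proof.
have pairP (a b : V) : a.1 = b.1 -> a.2 = b.2 -> a = b.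
  by case: a b => ? ? [? ?] /= -> ->.
apply: pairP.
  rewrite (raddf_sum (@fst X (dualv X))) /= {1}(coord_vbasis (memvf v.1)).
  by apply: eq_bigr => j _; rewrite scaler0 addr0 /ev /dual_basis lfunE.
rewrite (raddf_sum (@snd X (dualv X))) /=; apply/lfunP => x.
rewrite -[LHS](dual_basis_sum v.2 x) sum_lfunE; apply: eq_bigr => j _ /=.
by rewrite scaler0 add0r lfunE /= mulrC.
Qed.

Lemma id_tensE (S : 'End(V)) u v : id_tens S (tens u v) = tens u (S v).
Proof.
pose g (w : UV) := \sum_j
    (tens (w.1 (dual_basis j)) (S ((vbasis {:X})`_j, 0)) +
     tens (w.2 (vbasis {:X})`_j) (S (0, dual_basis j))).
have lg : linear g.
  move=> a w1 w2; rewrite /g scaler_sumr -big_split; apply: eq_bigr => j _ /=.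
  rewrite lfunE /= lfunE /= lfunE /= lfunE /= !linearPl /= scalerDr.
  by rewrite addrACA.
pose G : {linear UV -> UV} := HB.pack g (GRing.isLinear.Build _ _ _ _ g lg).
rewrite /id_tens (lfunE G) -[G _]/(g _) /g [in RHS](dual_basis_sumV v).
rewrite linear_sum linear_sumr; apply: eq_bigr => j _.
by rewrite tensE1 tensE2 !linearZl_LR linearD linearDr !linearZ.
Qed.

Definition iota_heis (beta : U -> U -> F) (u : U) (h : F * V) : F * UV :=
  (beta u u * h.1, tens u h.2).

End Tensor.

Section TensorRep.
Variables (R : realType) (F : finFieldType) (p : nat) (pF : p \in [pchar F]).
Variables (U X : vectType F) (beta : U -> U -> F).
Local Notation V := (X * dualv X)%type.
Local Notation UV := ('Hom(dualv X, U) * 'Hom(X, U))%type.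
Local Notation L2UV := (L2 R (finvect_type 'Hom(X, U))).

Definition clifford_u (u : U) (mu : 'End(UV) -> 'End(L2UV))
    (g : F * V * 'End(V)) : 'End(L2UV) :=
  (weyl R pF (tens_br beta) 1 (iota_heis beta u g.1) \o mu (id_tens U g.2))%VF.

End TensorRep.

(* Main.v *)
Require Import Defs.
From HB Require Import structures.
From mathcomp Require Import all_boot all_order all_algebra all_fingroup all_field.
From mathcomp Require Import complex.
From mathcomp Require Import boolp classical_sets functions reals trigo.
From mathcomp Require Import ring.

Set Implicit Arguments.
Unset Strict Implicit.
Unset Printing Implicit Defensive.

Import Order.TTheory GRing.Theory Num.Theory.
Local Open Scope classical_set_scope.
Local Open Scope ring_scope.

(** Why the correspondence holds.  Write U as the line of u plus the orthogonal
    complement U'.  Then Hom(X, U) = Hom(X, U') x X^*, so functions on Hom(X, U)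
    are the tensor product of the functions on Hom(X, U') and those on X^*.  In
    this picture the Heisenberg group acts through iota_u on the second factor
    only, by a Weyl representation of mass beta(u, u), and an element S of Sp(V)
    acts by mu'(S) tensored with some operator M(S) on the second factor.

    The Weyl operators span all operators on the second factor, because the sum
    of a nontrivial additive character over a space vanishes.  Hence a subspace
    stable under the Heisenberg group is K tensored with the whole second factor
    for a unique K; and since M(S) is not 0, it is stable under S exactly when K
    is stable under mu'(S).  An intertwiner between two such subspaces commutes
    with the matrix units of the second factor, so it comes from an intertwiner
    between the corresponding K.  This is [inflate_correspondence], and the
    condition on irreducible subspaces follows since inclusions are preserved
    ([irreducible_correspondence]).

    The factorisation of the action of S need only be checked on generators of
    Sp(V), since both sides are multiplicative; there it says that a quadratic
    form on U is the sum of its restrictions to U' and to the line of u.  The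
    existence of some operator M(S) is all that the previous paragraph asks for, so
    it is carried through products as an existential statement ([splits_Sp]).  That
    the elements N_A, D_C, J_B do generate is [Sp_generated].

    For tensor powers take U = F^t with the standard form and u = (1, .., 1), so
    that beta(u, u) = t.  What is needed is an orthogonal basis of F^t with norms
    1, .., 1, t, t whose last vector is u: its first t - 1 vectors turn the
    representation attached to U' into the tensor product of t - 2 copies of mass
    1 and one of mass t.  Write t = a^2 + b^2; the vectors (0, .., 0, -b, a) and
    (0, .., 0, a, b) together with the first t - 2 coordinate vectors form such a
    basis except that its last vector is not u, and an isometry, a reflection up
    to sign, carries that vector to u ([orthogonal_frame]). *)

(** * The additive character *)

Section Character.
Variables (R : realType) (F : finFieldType) (p : nat) (pF : p \in [pchar F]).

Lemma field_traceP (x : F) :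
  (field_trace pF x)%:A = galTrace 1%AS {: pPrimeCharType pF} x :> pPrimeCharType pF.
Proof.
rewrite /field_trace; case: pickP => [a /eqP // | no_a].
have /vlineP[a Da] : galTrace 1%AS {: pPrimeCharType pF} x \in 1%VS.
  by rewrite mem_galTrace ?memvf ?finField_galois ?subvf.
by have := no_a a; rewrite -Da eqxx.
Qed.

Lemma scaler1_inj : injective (fun a : 'F_p => a%:A : pPrimeCharType pF).
Proof. by move=> a b /eqP; rewrite -subr_eq0 -scalerBl scaler_eq0 oner_eq0 orbF subr_eq0 => /eqP. Qed.

Lemma field_traceD x y : field_trace pF (x + y) = field_trace pF x + field_trace pF y.
Proof.
apply: scaler1_inj; rewrite scalerDl !field_traceP.
exact: (raddfD (galTrace 1%AS {: pPrimeCharType pF})).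
Qed.

(** Automorphisms are linearly independent, so their sum is not the zero map. *)
Lemma field_trace_neq0 : exists x, field_trace pF x != 0.
Proof.
pose L := pPrimeCharType pF.
have G1 : (1%g : gal_of {: L}) \in 'Gal({: L} / 1%AS)%g by exact: group1.
have [a _ na] := @gal_independent_contra _ _ _ _ (fun=> 1 : L) _ G1 (oner_neq0 L).
exists a; apply: contraNneq na => ta; apply/eqP.
rewrite -[RHS](_ : (field_trace pF a)%:A = 0 :> L); last by rewrite ta scale0r.
by rewrite field_traceP /galTrace; apply: eq_bigr => i _; rewrite mul1r.
Qed.

Definition cexp (a : R) : R[i] := (cos a +i* sin a)%C.

Lemma cexpD a b : cexp (a + b) = cexp a * cexp b.
Proof. by rewrite /cexp cosD sinD /GRing.mul /= [sin a * cos b + _]addrC. Qed.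

Lemma cexp_period n : cexp (2 * pi * n%:R) = 1.
Proof.
elim: n => [|n IH]; first by rewrite mulr0 /cexp cos0 sin0.
rewrite -(addn1 n) (natrD _ n) mulrDr mulr1 cexpD IH mul1r /cexp.
by rewrite mulr_natl cos2pi sin2pi.
Qed.

Lemma prime_p : prime p. Proof. by case/andP: pF. Qed.

(** Every mass is reduced to mass 1: the character of mass m is x |-> chi (m * x). *)
Definition chi (x : F) : R[i] := omega R pF 1 x.

Lemma omegaE m x : omega R pF m x = chi (m * x).
Proof. by rewrite /chi /omega mul1r. Qed.

Lemma chiE x : chi x = cexp (2 * pi * (field_trace pF x)%:R / p%:R).
Proof. by rewrite /chi /omega mul1r. Qed.

(** The trace is additive modulo p only, so the two exponents may differ by a
    multiple of the period. *)
Lemma chiD x y : chi (x + y) = chi x * chi y.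
Proof.
have p0 : p%:R != 0 :> R by rewrite pnatr_eq0 -lt0n prime_gt0 ?prime_p.
rewrite !chiE -cexpD field_traceD -mulrDl -mulrDr -natrD.
set a := field_trace pF x; set b := field_trace pF y.
have -> : (a + b)%N%:R = ((a + b) %/ p)%N%:R * p%:R + (a + b)%R%:R :> R.
  rewrite {1}(divn_eq (a + b) p) -natrM -natrD; congr (_ + _)%N%:R.
  by congr (_ %% _)%N; rewrite Fp_cast ?prime_p.
rewrite (mulrDr _ (_ * _)) (mulrDl (_ * (_ * _))) cexpD (mulrA _ _ p%:R) mulfK //.
by rewrite cexp_period mul1r.
Qed.

Lemma chi0 : chi 0 = 1.
Proof.
have : field_trace pF 0 + field_trace pF 0 = field_trace pF 0.
  by rewrite -field_traceD addr0.
by rewrite chiE => /(canRL (addrK _)); rewrite subrr => ->; rewrite mulr0 mul0r /cexp cos0 sin0.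
Qed.

Lemma chi_nontrivial : exists x, chi x != 1.
Proof.
have [x tx] := field_trace_neq0; exists x; rewrite chiE.
have p0 : 0 < p%:R :> R by rewrite ltr0n prime_gt0 ?prime_p.
set a := field_trace pF x in tx *.
set h : R := pi * a%:R / p%:R.
have h0 : 0 < h < pi.
  have a0 : (0 < a)%N by rewrite lt0n; apply: contra tx => /eqP a0; apply/eqP/val_inj.
  have ap : (a < p)%N.
    by have := ltn_ord a; rewrite [X in (_ < X)%N -> _]Fp_cast ?prime_p.
  have a0R : 0 < a%:R :> R by rewrite ltr0n.
  apply/andP; split; first by rewrite divr_gt0 // mulr_gt0 // pi_gt0.
  by rewrite ltr_pdivrMr // ltr_pM2l ?pi_gt0 // ltr_nat.
have -> : 2 * pi * a%:R / p%:R = h *+ 2 by rewrite -(mulr_natl h 2) /h !mulrA.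
have sh := sin_gt0_pi h0.
rewrite /cexp eq_complex /= negb_and cos_mulr2n; apply/orP; left.
by rewrite cos2sin2 mulrnBl mulr2n addrAC addrK lt_eqF // gtrBl pmulrn_rgt0 // exprn_gt0.
Qed.

(** Translating x by a vector on which the character is not 1 multiplies the sum
    by that value. *)
Lemma chi_sum0 (Y : vectType F) (f : Y -> F) (x0 : Y) :
  linear (f : Y -> F^o) -> f x0 != 0 -> \sum_(x : finvect_type Y) chi (f x) = 0.
Proof.
move=> lf fx0; have [c chic] := chi_nontrivial.
have f0 : f 0 = 0 by have := lf (-1) 0 0; rewrite scaler0 addr0 scaleN1r addNr.
have fD x y : f (x + y) = f x + f y by have := lf 1 x y; rewrite !scale1r.
pose x1 : finvect_type Y := (c / f x0) *: x0.
have fx1 : f x1 = c.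
  by have := lf (c / f x0) x0 0; rewrite !addr0 f0 addr0 => ->; rewrite -[_ *: _]/(_ * _) divfK.
set s := \sum_x _.
have : s = chi c * s.
  rewrite /s mulr_sumr [LHS](reindex_inj (addrI x1)).
  by apply: eq_bigr => x _; rewrite -chiD -fx1 fD.
move/eqP; rewrite -subr_eq0 -{1}[s]mul1r -mulrBl mulf_eq0 subr_eq0 eq_sym (negPf chic).
by move/eqP.
Qed.

End Character.

(** * Perfect pairings and generators of the symplectic group *)

Lemma linfunE (F : fieldType) (aT rT : vectType F) (g : aT -> rT) :
  linear g -> forall x, linfun g x = g x.
Proof.
move=> lg; pose G : {linear aT -> rT} := HB.pack g (GRing.isLinear.Build _ _ _ _ g lg).
exact: (lfunE G).
Qed.

Section Symplectic.
Variables (F : finFieldType) (Y Z : vectType F) (br : Z -> Y -> F).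
Local Notation V := (Y * Z)%type.

Lemma opNE (A : 'Hom(Z, Y)) (v : V) : opN A v = (v.1 + A v.2, v.2).
Proof.
rewrite linfunE // => a [x1 z1] [x2 z2]; congr (_, _) => /=.
by rewrite linearP scalerDr /= addrACA.
Qed.

Lemma opDE (C : 'End(Y)) (C' : 'End(Z)) (v : V) : opD C C' v = (C v.1, C' v.2).
Proof. by rewrite linfunE // => a [x1 z1] [x2 z2]; congr (_, _) => /=; rewrite linearP. Qed.

Lemma opJE (B : 'Hom(Z, Y)) (v : V) : opJ B v = (B v.2, - (B^-1)%VF v.1).
Proof.
rewrite linfunE // => a [x1 z1] [x2 z2]; congr (_, _) => /=; rewrite linearP //=.
by rewrite opprD scalerN.
Qed.

Lemma pairDx a x x' : (a *: x + x', 0) = a *: (x, 0) + (x', 0) :> V.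
Proof. by apply: injective_projections; rewrite /= ?scaler0 ?addr0. Qed.

Lemma pairDz a z z' : (0, a *: z + z') = a *: (0, z) + (0, z') :> V.
Proof. by apply: injective_projections; rewrite /= ?scaler0 ?addr0. Qed.

Lemma pair_split x z : (x, z) = (x, 0) + (0, z) :> V.
Proof. by apply: injective_projections; rewrite /= ?addr0 ?add0r. Qed.

Local Notation Sp := (Sp br).
Local Notation lsym := (lsym br).
Implicit Types (x : Y) (z : Z) (A B : 'Hom(Z, Y)) (C : 'End(Y)) (S T : 'End(V)).

Lemma Sp_comp S T : Sp S -> Sp T -> Sp (S \o T)%VF.
Proof. by move=> sS sT v w; rewrite !comp_lfunE sS sT. Qed.

Lemma Sp_id : Sp \1%VF.
Proof. by move=> v w; rewrite !lfunE. Qed.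

(** The properties of the pairing between X and its dual from which everything about
    symplectic operators is derived.  The symmetric isomorphism gives a
    generator J_B, and the adjoint is the inverse transpose of an automorphism. *)
Record perfect_pairing : Prop := PerfectPairing {
  br_linear : forall x, linear (br^~ x : Z -> F^o);
  br_linearr : forall z, linear (br z : Y -> F^o);
  br_sep : forall x, (forall z, br z x = 0) -> x = 0;
  br_sepl : forall z, (forall x, br z x = 0) -> z = 0;
  br_sym_iso : exists B, [/\ lsym B, lker B = 0%VS & limg B = fullv];
  br_adj : forall C, lker C = 0%VS ->
    exists C' : 'End(Z), forall z x, br (C' z) (C x) = br z x
}.

Hypothesis pbr : perfect_pairing.

Lemma br0 x : br 0 x = 0.
Proof. by have := br_linear pbr x (-1) 0 0; rewrite scaler0 addr0 scaleN1r addNr. Qed.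
Lemma brD z z' x : br (z + z') x = br z x + br z' x.
Proof. by have := br_linear pbr x 1 z z'; rewrite !scale1r. Qed.
Lemma brZ a z x : br (a *: z) x = a * br z x.
Proof. by have := br_linear pbr x a z 0; rewrite !addr0 br0 addr0. Qed.
Lemma brN z x : br (- z) x = - br z x.
Proof. by rewrite -scaleN1r brZ mulN1r. Qed.
Lemma br0r z : br z 0 = 0.
Proof. by have := br_linearr pbr z (-1) 0 0; rewrite scaler0 addr0 scaleN1r addNr. Qed.
Lemma brDr z x x' : br z (x + x') = br z x + br z x'.
Proof. by have := br_linearr pbr z 1 x x'; rewrite !scale1r. Qed.
Lemma brZr a z x : br z (a *: x) = a * br z x.
Proof. by have := br_linearr pbr z a x 0; rewrite !addr0 br0r addr0. Qed.
Lemma brNr z x : br z (- x) = - br z x.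
Proof. by rewrite -scaleN1r brZr mulN1r. Qed.
Lemma br_inj z z' : (forall x, br z x = br z' x) -> z = z'.
Proof.
move=> e; apply/eqP; rewrite -subr_eq0; apply/eqP/(br_sepl pbr) => x.
by rewrite brD brN e subrr.
Qed.
Lemma br_neq0 z : z != 0 -> exists x, br z x != 0.
Proof.
move=> z0; apply: contrapT => nx; case/negP: z0; apply/eqP/(br_sepl pbr) => x.
by apply: contrapT => /eqP zx; apply: nx; exists x.
Qed.

Lemma Sp_opN A : lsym A -> Sp (opN A).
Proof.
move=> sA [x z] [x' z']; rewrite /symp_form !opNE /= !brDr.
by rewrite [br z (A z')](sA z' z) /lbil opprD addrACA subrr addr0.
Qed.

Lemma Sp_opD C (C' : 'End(Z)) : (forall z x, br (C' z) (C x) = br z x) -> Sp (opD C C').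
Proof. by move=> sC [x z] [x' z']; rewrite /symp_form !opDE /= !sC. Qed.

Lemma Sp_opJ B : lsym B -> lker B = 0%VS -> limg B = fullv -> Sp (opJ B).
Proof.
move=> sB kB iB [x z] [x' z']; rewrite /symp_form !opJE /= !brN.
have BK y : B ((B^-1)%VF y) = y by rewrite limg_lfunVK // iB memvf.
rewrite -[br ((B^-1)%VF x') (B z)]/(lbil br B _ _) sB /lbil BK.
by rewrite -[br _ (B z')]/(lbil br B _ _) sB /lbil BK opprK addrC.
Qed.

(** The symplectic form is nondegenerate. *)
Lemma Sp_inj S : Sp S -> lker S = 0%VS.
Proof.
move=> sS; apply/eqP; rewrite -subv0; apply/subvP => -[x z]; rewrite memv_ker => /eqP S0.
have v0 w : symp_form br (x, z) w = 0.
  by rewrite -sS S0 /symp_form /= br0 br0r subr0.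
rewrite memv0; apply/eqP; congr (_, _).
  by apply: (br_sep pbr) => z'; have := v0 (0, z'); rewrite /symp_form /= br0r subr0.
apply: br_inj => x'; have := v0 (x', 0).
by rewrite /symp_form /= !br0 sub0r => /eqP; rewrite oppr_eq0 => /eqP.
Qed.

Lemma Sp_inv S : Sp S -> Sp (S^-1)%VF /\ (S \o S^-1 = \1)%VF.
Proof.
move=> sS; have kS := introT eqP (Sp_inj sS); have SK := lker0_lfunVK kS.
split; first by move=> v w; rewrite -sS !SK.
by apply/lfunP => v; rewrite !lfunE /= SK.
Qed.

Definition upper_left_block S : 'End(Y) := linfun (fun x => (S (x, 0)).1).

Lemma upper_left_blockE S x : upper_left_block S x = (S (x, 0)).1.
Proof.
rewrite linfunE // => a y y'.
rewrite -[RHS]/(a *: S (y, 0) + S (y', 0)).1 -linearP.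
by rewrite -pairDx.
Qed.

Section Generation.
Variable P : 'End(V) -> Prop.
Hypothesis Pcomp : forall S T, Sp S -> Sp T -> P S -> P T -> P (S \o T)%VF.
Hypothesis PN : forall A, lsym A -> P (opN A).
Hypothesis PD : forall C (C' : 'End(Z)), lker C = 0%VS -> (forall z x, br (C' z) (C x) = br z x) -> P (opD C C').
Hypothesis PJ : forall B, lsym B -> lker B = 0%VS -> limg B = fullv -> P (opJ B).

(** The lower-diagonal-upper factorisation, with a, b, c, d the blocks of T.  The
    lower triangular factor is a conjugate of an upper triangular one by a J_B. *)
Lemma Sp_big_cell T : Sp T -> lker (upper_left_block T) = 0%VS -> P T.
Proof.
move=> sT kT; have [B0 [B0_sym B0_ker B0_img]] := br_sym_iso pbr; set a := upper_left_block T in kT.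
have kT' : lker a == 0%VS by apply/eqP.
have aK := lker0_lfunVK kT'; have Ka := lker0_lfunK kT'.
pose ai : 'End(Y) := (a^-1)%VF.
pose b : 'Hom(Z, Y) := linfun (fun z => (T (0, z)).1).
pose c : 'Hom(Y, Z) := linfun (fun x => (T (x, 0)).2).
pose d : 'End(Z) := linfun (fun z => (T (0, z)).2).
have bE z : b z = (T (0, z)).1.
  rewrite linfunE // => k y y'; rewrite -[RHS]/(k *: T (0, y) + T (0, y')).1 -linearP.
  by rewrite -pairDz.
have cE x : c x = (T (x, 0)).2.
  rewrite linfunE // => k y y'; rewrite -[RHS]/(k *: T (y, 0) + T (y', 0)).2 -linearP.
  by rewrite -pairDx.
have dE z : d z = (T (0, z)).2.
  rewrite linfunE // => k y y'; rewrite -[RHS]/(k *: T (0, y) + T (0, y')).2 -linearP.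
  by rewrite -pairDz.
have aE x : a x = (T (x, 0)).1 by apply: upper_left_blockE.
have TE x z : T (x, z) = (a x + b z, c x + d z).
  by rewrite pair_split linearD aE bE cE dE.
have ac x x' : br (c x) (a x') = br (c x') (a x).
  have := sT (x, 0) (x', 0); rewrite !TE !linear0 !addr0 /symp_form /= !br0 subr0.
  by move/eqP; rewrite subr_eq0 => /eqP.
have bd z z' : br (d z) (b z') = br (d z') (b z).
  have := sT (0, z) (0, z'); rewrite !TE !linear0 !add0r /symp_form /= !br0r subr0.
  by move/eqP; rewrite subr_eq0 => /eqP.
have ad x z : br (d z) (a x) = br z x + br (c x) (b z).
  have := sT (x, 0) (0, z); rewrite !TE !linear0 !add0r !addr0 /symp_form /= br0 subr0.
  by move=> <-; rewrite subrK.
pose G : 'Hom(Y, Z) := (c \o ai)%VF.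
have GE x : G x = c (ai x) by rewrite /G lfunE.
(* The isotropy of the image of X under T makes c a^-1 symmetric. *)
have Gs x x' : br (G x) x' = br (G x') x.
  by rewrite !GE -{1}[x']aK ac aK.
have [Cd sD] := br_adj pbr kT.
have CdE z x : br (Cd z) x = br z (ai x) by rewrite -[RHS]sD aK.
pose N : 'Hom(Z, Y) := (ai \o b)%VF.
have NE z : N z = ai (b z) by rewrite /N lfunE.
have Ns : lsym N.
  have e z z' : br z' (N z) = br (d z') (b z) - br (c (N z)) (b z').
    have -> : b z = a (N z) by rewrite NE aK.
    by rewrite ad addrK.
  move=> z z'; rewrite /lbil !e bd; congr (_ - _).
  by rewrite -[b z']aK ac NE aK NE.
pose A : 'Hom(Z, Y) := (- (B0 \o G \o B0))%VF.
have AE z : A z = - B0 (G (B0 z)) by rewrite opp_lfunE !comp_lfunE.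
have As : lsym A.
  move=> z z'; rewrite /lbil !AE !brNr; congr (- _).
  have s := B0_sym; rewrite /Defs.lsym /lbil in s.
  by rewrite s Gs s.
have BK y : B0 ((B0^-1)%VF y) = y by rewrite limg_lfunVK // B0_img memvf.
have KB : cancel B0 (B0^-1)%VF by apply: lker0_lfunK; rewrite B0_ker.
have sJ := Sp_opJ B0_sym B0_ker B0_img; have pJ := PJ B0_sym B0_ker B0_img.
(* The square of J_B is -1, so its inverse is its cube. *)
have JJ v : opJ B0 (opJ B0 v) = - v.
  by rewrite !opJE /= linearN /= BK KB; case: v.
have lowE v : opJ B0 (opN A (opJ B0 (opJ B0 (opJ B0 v)))) = (v.1, v.2 + G v.1).
  case: v => x z; rewrite JJ !opJE opNE /= AE !opprK.
  by congr (_, _); rewrite ?linearN ?linearD /= ?opprK ?linearN /= ?BK ?KB ?opprD ?opprK //.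
have DNE x z : opD a Cd (opN N (x, z)) = (a x + b z, Cd z).
  by rewrite opNE opDE /= linearD /= NE aK.
have -> : T = (opJ B0 \o (opN A \o (opJ B0 \o (opJ B0 \o (opJ B0 \o
                 (opD a Cd \o opN N))))))%VF.
  apply/lfunP => -[x z]; rewrite !comp_lfunE lowE DNE TE /=; congr (_, _).
  apply: br_inj => w; rewrite -[w]aK !brD GE linearD /= Ka linearD /= !brD.
  rewrite ad CdE [br (c (ai (b z))) _]ac aK addrCA; congr (_ + (_ + _)).
  by rewrite /ai aK.
have sAN := Sp_opN As; have sNN := Sp_opN Ns; have sDD := Sp_opD sD.
have pAN := PN As; have pNN := PN Ns; have pDD := PD kT sD.
by do !apply: Pcomp => //; do !apply: Sp_comp.
Qed.

(** Multiplying S by suitable N_A makes its block a injective.  If a kills x0, then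
    z0 = c x0 is not 0; choose m with z0(m) != 0 and A of rank one with image
    spanned by m.  Evaluating z0 shows that the kernel of a + A c lies in the kernel
    of a, and it no longer contains x0. *)
Lemma Sp_generated S : Sp S -> P S.
Proof.
have [n] := ubnP (\dim (lker (upper_left_block S))); elim: n S => // n IH S ltS sS.
have [/eqP k0|] := boolP (lker (upper_left_block S) == 0%VS); first exact: Sp_big_cell.
set K := lker _ in ltS * => K0.
pose x0 := vpick K; have x0K : x0 \in K by apply: memv_pick.
have x00 : x0 != 0 by rewrite vpick0.
have Sx0 : (S (x0, 0)).1 = 0 by move: x0K; rewrite memv_ker upper_left_blockE => /eqP.
pose z0 := (S (x0, 0)).2.
have z00 : z0 != 0.
  apply: contraNneq x00 => z00; have : (x0, 0) \in lker S.
    by rewrite memv_ker [S _]surjective_pairing Sx0 -/z0 z00.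
  by rewrite Sp_inj // memv0 => /eqP[->].
have [m zm] := br_neq0 z00.
pose A : 'Hom(Z, Y) := linfun (fun z => br z m *: m).
have AE z : A z = br z m *: m.
  by rewrite linfunE // => k y y'; rewrite brD brZ scalerDl scalerA.
have sA : lsym A by move=> z z'; rewrite /lbil !AE !brZr mulrC.
have sNA : lsym (- A)%VF by move=> z z'; have := sA z z'; rewrite /lbil !lfunE /= !brNr => ->.
have -> : S = (opN (- A) \o (opN A \o S))%VF.
  apply/lfunP => v; rewrite !comp_lfunE !opNE /= lfunE /= addrK; exact: surjective_pairing.
have sS' : Sp (opN A \o S)%VF by apply: Sp_comp => //; apply: Sp_opN.
apply: Pcomp => //; [exact: Sp_opN | exact: PN | apply: IH => //].
rewrite -ltnS; apply: leq_trans ltS; rewrite ltnS.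
have ulE x : upper_left_block (opN A \o S)%VF x = upper_left_block S x + br (S (x, 0)).2 m *: m.
  by rewrite !upper_left_blockE comp_lfunE opNE /= AE.
have sub : (lker (upper_left_block (opN A \o S)%VF) <= K)%VS.
  apply/subvP => x; rewrite !memv_ker ulE => /eqP e.
  have e' : br z0 (upper_left_block S x) = 0.
    have := sS (x, 0) (x0, 0); rewrite /symp_form /= !br0 subr0 Sx0 br0r subr0.
    by rewrite upper_left_blockE.
  have : br z0 (upper_left_block S x + br (S (x, 0)).2 m *: m) = 0 by rewrite e br0r.
  rewrite brDr e' add0r brZr => /eqP; rewrite mulf_eq0 (negPf zm) orbF => /eqP em.
  by move: e; rewrite em scale0r addr0 => ->.
rewrite ltn_neqAle dimvS // andbT.
apply: contraL x0K => /eqP ed; rewrite -(eqP (_ : lker (upper_left_block (opN A \o S)%VF) == K)).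
  rewrite memv_ker ulE upper_left_blockE Sx0 add0r scaler_eq0 (negPf zm) /=.
  by apply: contraNneq zm => ->; rewrite br0r.
by rewrite eqEdim sub ed leqnn.
Qed.

End Generation.
End Symplectic.

(** * The pairing between a space and its dual *)

Section Duality.
Variables (F : finFieldType) (X : vectType F).
Local Notation Xd := (dualv X).
Implicit Types (x : X) (z : Xd).
Local Notation lsym := (lsym (@ev F X)).

Lemma evD z z' x : ev (z + z') x = ev z x + ev z' x.
Proof. by rewrite /ev lfunE. Qed.
Lemma evZ a z x : ev (a *: z) x = a * ev z x.
Proof. by rewrite /ev lfunE. Qed.
Lemma ev0 x : ev (0 : Xd) x = 0.
Proof. by rewrite /ev lfunE. Qed.
Lemma evDr z x x' : ev z (x + x') = ev z x + ev z x'.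
Proof. by rewrite /ev linearD. Qed.
Lemma evZr a z x : ev z (a *: x) = a * ev z x.
Proof. by rewrite /ev linearZ. Qed.
Lemma ev_inj z z' : (forall x, ev z x = ev z' x) -> z = z'.
Proof. by move=> e; apply/lfunP. Qed.

Lemma coord_ev x (j : 'I_(\dim {:X})) : coord (vbasis {:X}) j x = ev (dual_basis j) x.
Proof. by rewrite /ev /dual_basis lfunE. Qed.

Lemma ev_sep x : (forall z, ev z x = 0) -> x = 0.
Proof.
move=> zx; rewrite (coord_vbasis (memvf x)) big1 // => j _.
by rewrite coord_ev zx scale0r.
Qed.

(** The identification of the dual with X in which the chosen basis is orthonormal. *)
Definition std_iso : 'Hom(Xd, X) := linfun (fun z => \sum_(j < \dim {:X}) ev z (vbasis {:X})`_j *: (vbasis {:X})`_j).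

Lemma std_isoE z : std_iso z = \sum_(j < \dim {:X}) ev z (vbasis {:X})`_j *: (vbasis {:X})`_j.
Proof.
rewrite linfunE // => a z1 z2; rewrite scaler_sumr -big_split; apply: eq_bigr => j _ /=.
by rewrite evD evZ scalerDl scalerA.
Qed.

Lemma std_iso_sym : lsym std_iso.
Proof.
move=> z z'; rewrite /lbil !std_isoE /ev !linear_sum; apply: eq_bigr => j _ /=.
by rewrite !linearZ; apply: mulrC.
Qed.

Lemma std_iso_ker : lker std_iso = 0%VS.
Proof.
apply/eqP; rewrite -subv0; apply/subvP => z; rewrite memv_ker memv0 std_isoE => /eqP z0.
have zj (j : 'I_(\dim {:X})) : ev z (vbasis {:X})`_j = 0.
  have := coord_sum_free (fun j : 'I_(\dim {:X}) => ev z (vbasis {:X})`_j) j (basis_free (vbasisP {:X})).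
  by rewrite z0 linear0.
apply/eqP/ev_inj => x; rewrite ev0 -dual_basis_sum big1 // => j _.
by rewrite zj mulr0.
Qed.

Lemma std_iso_img : limg std_iso = fullv.
Proof.
apply/eqP; rewrite eqEsubv subvf /=; apply/subvP => x _.
apply/memv_imgP; exists (\sum_j coord (vbasis {:X}) j x *: dual_basis j); rewrite ?memvf //.
rewrite std_isoE {1}(coord_vbasis (memvf x)); apply: eq_bigr => i _; congr (_ *: _).
rewrite /ev sum_lfunE (bigD1 i) //= big1 ?addr0.
  by rewrite lfunE /= -/(ev _ _) -coord_ev coord_free ?(basis_free (vbasisP _)) // eqxx; apply/esym/mulr1.
move=> j ji; rewrite lfunE /= -/(ev _ _) -coord_ev coord_free ?(basis_free (vbasisP _)) //.
by rewrite eq_sym (negPf ji); apply: mulr0.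
Qed.

Lemma dual_adj (C : 'End(X)) : lker C = 0%VS ->
  exists C' : 'End(Xd), forall z x, ev (C' z) (C x) = ev z x.
Proof.
move=> kC; have CK : cancel C (C^-1)%VF by apply: lker0_lfunK; rewrite kC.
exists (linfun (fun z : Xd => (z \o C^-1)%VF : Xd)) => z x.
rewrite linfunE; first by rewrite /ev comp_lfunE CK.
by move=> k y y'; apply/lfunP => w; rewrite !(comp_lfunE, add_lfunE, scale_lfunE).
Qed.

Lemma ev_perfect : perfect_pairing (@ev F X).
Proof.
split; [| |exact: ev_sep| |by exists std_iso; split; [exact: std_iso_sym|exact: std_iso_ker|exact: std_iso_img]|exact: dual_adj].
- by move=> x k z z'; rewrite evD evZ.
- by move=> z k x x'; rewrite evDr evZr.
- by move=> z zx; apply: ev_inj => x; rewrite zx ev0.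
Qed.

End Duality.

(** * Subspaces of a tensor product stable under all operators of one factor *)

Section DeltaBasis.
Variable R : realType.
Implicit Types S T : finType.

Lemma L2_expand S (f : L2 R S) : f = \sum_s (f s : R[i]) *: delta R s.
Proof.
apply/ffunP => s; rewrite sum_ffunE (bigD1 s) //= !ffunE eqxx big1 ?addr0.
  by apply/esym/mulr1.
by move=> i si; rewrite !ffunE eq_sym (negPf si); apply: mulr0.
Qed.

Lemma op_of_sum S T (phi : S -> L2 R T) f : op_of phi f = \sum_s (f s : R[i]) *: phi s.
Proof.
rewrite {1}[f]L2_expand linear_sum; apply: eq_bigr => s _.
by rewrite linearZ /= op_ofE.
Qed.

Lemma delta_ext S T (A B : 'Hom(L2 R S, L2 R T)) :
  (forall s, A (delta R s) = B (delta R s)) -> A = B.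
Proof.
move=> e; apply/lfunP => f; rewrite [f]L2_expand !linear_sum.
by apply: eq_bigr => s _; rewrite !linearZ /= e.
Qed.

Lemma delta_neq0 S (s : S) : delta R s != 0.
Proof. by apply/eqP => /ffunP/(_ s)/eqP; rewrite !ffunE eqxx oner_eq0. Qed.

End DeltaBasis.

Section Correspondence.
Variables (R : realType) (S1 S2 Z : finType) (z0 : Z).
Local Notation L1 := (L2 R S1).
Local Notation L2' := (L2 R S2).
(* L2 R S2 is L2 R S1 tensored with functions on Z: em z is f |-> f (x) delta z
   and sl z is its left inverse, so em z sl w is a matrix unit of the factor. *)
Variables (em : Z -> 'Hom(L1, L2')) (sl : Z -> 'Hom(L2', L1)).
Hypothesis sl_em : forall z w f, sl z (em w f) = if z == w then f else 0.
Hypothesis sum_em_sl : forall f, f = \sum_z em z (sl z f).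
Variables (G1 G2 : Type) (D1 : set G1) (D2 : set G2).
Variables (rho1 : G1 -> 'End(L1)) (rho2 : G2 -> 'End(L2')).

Lemma sl_comb (c : Z -> R[i]) z f : sl z (\sum_w c w *: em w f) = c z *: f.
Proof.
rewrite linear_sum (@big_only1 _ _ _ _ z) // => [|w wz _].
  by rewrite linearZ /= sl_em eqxx.
by rewrite linearZ /= sl_em eq_sym (negPf wz) scaler0.
Qed.

(** The operator rho2 g2 is rho1 g1 tensored with the matrix M. *)
Definition block_form g2 g1 (M : Z -> Z -> R[i]) := forall w f,
  rho2 g2 (em w f) = \sum_z M z w *: em z (rho1 g1 f).

Hypothesis matrix_units : forall z w, exists (I : finType) (c : I -> R[i]) (g : I -> G2),
  (forall i, D2 (g i)) /\ (forall f, em z (sl w f) = \sum_i c i *: rho2 (g i) f).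
Hypothesis blocks_of : forall g2, D2 g2 -> exists2 g1, D1 g1 & exists M, block_form g2 g1 M.
Hypothesis blocks_onto : forall g1, D1 g1 -> exists2 g2, D2 g2 &
  exists M z w, block_form g2 g1 M /\ M z w != 0.

(** K tensored with all functions on Z. *)
Definition inflate (K : {vspace L1}) : {vspace L2'} := (\bigcap_z (sl z @^-1: K))%VS.

Implicit Types (K : {vspace L1}) (L : {vspace L2'}).

Lemma mem_inflate K f : reflect (forall z, sl z f \in K) (f \in inflate K).
Proof.
rewrite memvE; apply: (iffP subv_bigcapP) => [H z|H z _]; last first.
  by rewrite -memvE -memv_preim.
by have := H z isT; rewrite -memvE -memv_preim.
Qed.

Lemma em_inflate K z k : k \in K -> em z k \in inflate K.
Proof. by move=> kK; apply/mem_inflate => w; rewrite sl_em; case: eqP; rewrite ?mem0v. Qed.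

Lemma inflate_le K K' : (inflate K <= inflate K')%VS = (K <= K')%VS.
Proof.
apply/subvP/subvP => [H k kK|H f /mem_inflate fK]; last first.
  by apply/mem_inflate => z; apply: H.
by have /mem_inflate/(_ z0) := H _ (em_inflate z0 kK); rewrite sl_em eqxx.
Qed.

Lemma invariant_subP (S : finType) (G : Type) (D : set G) (rho : G -> 'End(L2 R S)) (K : {vspace L2 R S}) :
  invariant_sub D rho K <-> forall g, D g -> forall f, f \in K -> rho g f \in K.
Proof.
split=> [H g Dg f fK|H g Dg]; first by apply: (subvP (H g Dg)); apply: memv_img.
by apply/subvP => _ /memv_imgP[f fK ->]; apply: H.
Qed.

Lemma inflate_inv K : invariant_sub D1 rho1 K -> invariant_sub D2 rho2 (inflate K).
Proof.
move=> /invariant_subP iK; apply/invariant_subP => g2 /blocks_of[g1 Dg1 [M Mg]] f /mem_inflate fK.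
rewrite [f]sum_em_sl linear_sum memv_suml // => w _; rewrite /= Mg memv_suml // => z _.
by apply/memvZ/em_inflate/iK.
Qed.

(** This is where irreducibility of the second factor enters: L is stable under all
    of its matrix units. *)
Lemma unit_closed L z w f : invariant_sub D2 rho2 L -> f \in L -> em z (sl w f) \in L.
Proof.
move=> /invariant_subP iL fL; have [I [c [g [Dg ->]]]] := matrix_units z w.
by apply: memv_suml => i _; apply/memvZ/iL.
Qed.

(** A subspace stable under matrix units is recovered from any one of its slices. *)
Lemma inflate_surj L : invariant_sub D2 rho2 L ->
  exists2 K, invariant_sub D1 rho1 K & inflate K = L.
Proof.
move=> iL; pose K := (sl z0 @: L)%VS.
have slK z f : f \in L -> sl z f \in K.
  move=> fL; have -> : sl z f = sl z0 (em z0 (sl z f)) by rewrite sl_em eqxx.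
  by apply/memv_img/unit_closed.
exists K; last first.
  apply/eqP; rewrite eqEsubv; apply/andP; split; apply/subvP => f.
    move=> /mem_inflate fK; rewrite [f]sum_em_sl memv_suml // => z _.
    by have /memv_imgP[f' f'L ->] := fK z; apply: unit_closed.
  by move=> fL; apply/mem_inflate => z; apply: slK.
apply/invariant_subP => g1 /blocks_onto[g2 Dg2 [M [z [w [Mg M0]]]]] _ /memv_imgP[f fL ->].
have /invariant_subP/(_ _ Dg2) i2 := iL.
have := slK z _ (i2 _ (unit_closed w z0 iL fL)).
rewrite Mg sl_comb.
by move/(memvZ (M z w)^-1); rewrite scalerA mulVf // scale1r.
Qed.

(** Apply the given intertwiner slice by slice. *)
Lemma inflate_iso K K' : rep_iso D1 rho1 K K' -> invariant_sub D1 rho1 K ->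
  rep_iso D2 rho2 (inflate K) (inflate K').
Proof.
move=> [T1 [imT kT iT]] /invariant_subP iK; pose T2 : 'End(L2') := \sum_z (em z \o (T1 \o sl z))%VF.
have T2E f : T2 f = \sum_z em z (T1 (sl z f)).
  by rewrite sum_lfunE; apply: eq_bigr => z _; rewrite !comp_lfunE.
have T2em w k : T2 (em w k) = em w (T1 k).
  rewrite T2E (bigD1 w) //= sl_em eqxx big1 ?addr0 // => z zw.
  by rewrite sl_em (negPf zw) !linear0.
have slT2 z f : sl z (T2 f) = T1 (sl z f).
  rewrite T2E linear_sum (bigD1 z) //= sl_em eqxx big1 ?addr0 // => w wz.
  by rewrite sl_em eq_sym (negPf wz).
exists T2; split.
- apply/eqP; rewrite eqEsubv; apply/andP; split; apply/subvP => f.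
    case/memv_imgP => f' /mem_inflate f'K ->; apply/mem_inflate => z.
    by rewrite slT2 -imT memv_img.
  move=> /mem_inflate fK; rewrite [f]sum_em_sl memv_suml // => z _.
  have := fK z; rewrite -imT => /memv_imgP[k kK ->].
  by rewrite -T2em memv_img // em_inflate.
- apply/eqP; rewrite -subv0; apply/subvP => f; rewrite memv_cap memv_ker memv0.
  case/andP => /mem_inflate fK /eqP Tf; rewrite [f]sum_em_sl big1 // => z _.
  suff : sl z f \in (K :&: lker T1)%VS by rewrite kT memv0 => /eqP->; rewrite linear0.
  by rewrite memv_cap fK memv_ker -slT2 Tf linear0 eqxx.
- move=> g2 /blocks_of[g1 Dg1 [M Mg]] f /mem_inflate fK.
  rewrite [f]sum_em_sl !linear_sum /=; apply: eq_bigr => w _.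
  rewrite T2em !Mg linear_sum; apply: eq_bigr => z _.
  by rewrite linearZ /= T2em iT.
Qed.

(** An intertwiner commutes with the matrix units, so it acts in the same way on
    every slice; that common action is the intertwiner sought. *)
Lemma deflate_iso K K' : rep_iso D2 rho2 (inflate K) (inflate K') ->
  invariant_sub D1 rho1 K -> rep_iso D1 rho1 K K'.
Proof.
move=> [T2 [imT kT iT]] /invariant_subP iK; pose T1 : 'End(L1) := (sl z0 \o (T2 \o em z0))%VF.
have T1E k : T1 k = sl z0 (T2 (em z0 k)) by rewrite /T1 !comp_lfunE.
have comm z w f : f \in inflate K -> T2 (em z (sl w f)) = em z (sl w (T2 f)).
  move=> fK; have [I [c [g [Dg ge]]]] := matrix_units z w.
  rewrite !ge linear_sum; apply: eq_bigr => i _.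
  by rewrite linearZ /= iT.
have T2em z k : k \in K -> T2 (em z k) = em z (T1 k).
  by move=> kK; rewrite T1E -comm ?em_inflate // sl_em eqxx.
clearbody T1; exists T1; split.
- apply/eqP; rewrite eqEsubv; apply/andP; split; apply/subvP => k.
    case/memv_imgP => k' k'K ->; rewrite T1E.
    by move: (memv_img T2 (em_inflate z0 k'K)); rewrite imT => /mem_inflate.
  move=> kK; have := em_inflate z0 kK; rewrite -imT => /memv_imgP[f fK fE].
  apply/memv_imgP; exists (sl z0 f); first by move/mem_inflate: fK.
  by rewrite T1E comm // -fE !sl_em eqxx.
- apply/eqP; rewrite -subv0; apply/subvP => k; rewrite memv_cap memv_ker memv0.
  case/andP => kK /eqP Tk; have : em z0 k \in (inflate K :&: lker T2)%VS.
    by rewrite memv_cap em_inflate // memv_ker T2em // Tk linear0 eqxx.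
  rewrite kT memv0 => /eqP ek; have := sl_em z0 z0 k.
  by rewrite ek eqxx linear0 => <-; rewrite eqxx.
- move=> g1 Dg1 k kK; have [g2 Dg2 [M [z [w [Mg M0]]]]] := blocks_onto Dg1.
  have T2M : T2 (rho2 g2 (em w k)) = \sum_z M z w *: em z (T1 (rho1 g1 k)).
    by rewrite Mg linear_sum; apply: eq_bigr => i _; rewrite linearZ /= T2em ?iK.
  have e : M z w *: T1 (rho1 g1 k) = M z w *: rho1 g1 (T1 k).
    transitivity (sl z (T2 (rho2 g2 (em w k)))); first by rewrite T2M; apply/esym/sl_comb.
    by rewrite iT ?em_inflate // T2em // Mg; apply: sl_comb.
  by move: e => /(scalerI M0).
Qed.

(** Since K is tensored with every function on Z, a nonzero matrix M acting on that
    factor cannot affect invariance, which rho1 alone decides. *)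
Theorem inflate_correspondence :
  correspondence (invariant_sub D1 rho1) (rep_iso D1 rho1)
                 (invariant_sub D2 rho2) (rep_iso D2 rho2).
Proof.
exists inflate; split.
- split=> [K iK|K K' _ _ e|L iL]; first exact: inflate_inv.
    by apply/eqP; rewrite eqEsubv -!inflate_le e subvv.
  by have [K iK <-] := inflate_surj iL; exists K.
- by move=> K K' _ _; apply: inflate_le.
- by move=> K K' iK _; split=> ?; [apply: deflate_iso|apply: inflate_iso].
Qed.

End Correspondence.

(** An isomorphism of the posets of invariant subspaces fixes 0 and matches the
    minimal nonzero elements. *)
Lemma irreducible_correspondence (R : realType) (S1 S2 : finType) (G1 G2 : Type)
    (D1 : set G1) (D2 : set G2) (rho1 : G1 -> 'End(L2 R S1)) (rho2 : G2 -> 'End(L2 R S2)) :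
  correspondence (invariant_sub D1 rho1) (rep_iso D1 rho1)
                 (invariant_sub D2 rho2) (rep_iso D2 rho2) ->
  correspondence (irreducible_sub D1 rho1) (rep_iso D1 rho1)
                 (irreducible_sub D2 rho2) (rep_iso D2 rho2).
Proof.
case=> Phi [[Phi_fun Phi_inj Phi_surj] Phi_le Phi_iso].
have i01 : invariant_sub D1 rho1 0%VS by move=> g _; rewrite limg0 sub0v.
have i02 : invariant_sub D2 rho2 0%VS by move=> g _; rewrite limg0 sub0v.
have Phi0 : Phi 0%VS = 0%VS.
  have [K iK K0] := Phi_surj _ i02.
  by apply/eqP; rewrite -subv0 -K0 Phi_le // sub0v.
have irr K : invariant_sub D1 rho1 K ->
    irreducible_sub D2 rho2 (Phi K) <-> irreducible_sub D1 rho1 K.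
  move=> iK; split=> -[_ K0 Kmin]; split=> //.
  - by apply: contra_neq K0 => ->.
  - move=> K' iK' sK'; have [] := Kmin (Phi K').
    + exact: Phi_fun.
    + by rewrite Phi_le.
    + by rewrite -Phi0 => /(Phi_inj _ _ (mem_set iK') (mem_set i01)); left.
    + by move=> /(Phi_inj _ _ (mem_set iK') (mem_set iK)); right.
  - exact: Phi_fun.
  - by apply: contra_neq K0; rewrite -Phi0 => /(Phi_inj _ _ (mem_set iK) (mem_set i01)).
  - move=> L iL; have [K' iK' <-] := Phi_surj _ iL; rewrite Phi_le // => sK'.
    by have [->|->] := Kmin _ iK' sK'; [left|right].
have inv1 K : irreducible_sub D1 rho1 K -> invariant_sub D1 rho1 K by case.
exists Phi; split.
- split=> [K iK|K K'|L iL].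
  + by apply/irr => //; apply: inv1.
  + by rewrite !inE => /inv1 iK /inv1 iK' /=; apply: Phi_inj; apply: mem_set.
  + have [iL' _ _] := iL; have [K iK KL] := Phi_surj _ iL'.
    by exists K => //; apply/(irr K iK); rewrite KL.
- by move=> K K' /inv1 iK /inv1 iK'; apply: Phi_le.
- by move=> K K' /inv1 iK /inv1 iK'; apply: Phi_iso.
Qed.

(** * Tensor products and powers of operators; representations given on generators *)

Section TensorOperators.
Variable R : realType.

Definition tens_fun (S T : finType) (f : L2 R S) (g : L2 R T) : L2 R (S * T)%type :=
  [ffun w => (f w.1 : R[i]) * g w.2].

Lemma tens_funZ (S T : finType) (f : L2 R S) (g : L2 R T) (a b : R[i]) :
  tens_fun (a *: f) (b *: g) = (a * b) *: tens_fun f g.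
Proof. by apply/ffunP => w; rewrite !ffunE; apply: mulrACA. Qed.

Lemma delta_pair (S T : finType) (s : S) (t : T) :
  delta R (s, t) = tens_fun (delta R s) (delta R t).
Proof. by apply/ffunP => -[s' t']; rewrite !ffunE xpair_eqE -natrM mulnb. Qed.

Lemma tens_op_delta (S T : finType) (A : 'End(L2 R S)) (B : 'End(L2 R T)) s t :
  tens_op A B (delta R (s, t)) = tens_fun (A (delta R s)) (B (delta R t)).
Proof. by rewrite op_ofE. Qed.

Lemma tens_opE (S T : finType) (A : 'End(L2 R S)) (B : 'End(L2 R T)) f g :
  tens_op A B (tens_fun f g) = tens_fun (A f) (B g).
Proof.
rewrite op_of_sum; apply/ffunP => w; rewrite sum_ffunE !ffunE.
rewrite [f in RHS]L2_expand [g in RHS]L2_expand !linear_sum !sum_ffunE big_distrlr /=.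
rewrite pair_bigA; apply: eq_bigr => -[s t] _ /=.
by rewrite !linearZ /= !ffunE; apply: mulrACA.
Qed.

Lemma tens_op_comp (S T : finType) (A A' : 'End(L2 R S)) (B B' : 'End(L2 R T)) :
  tens_op (A \o A')%VF (B \o B')%VF = (tens_op A B \o tens_op A' B')%VF.
Proof.
apply: delta_ext => -[s t].
transitivity (tens_op A B (tens_op A' B' (delta R (s, t)))); last exact/esym/comp_lfunE.
rewrite [LHS]tens_op_delta [X in _ = tens_op A B X]tens_op_delta [RHS]tens_opE.
by congr (tens_fun _ _); apply: comp_lfunE.
Qed.

Lemma tens_op_id (S T : finType) : tens_op \1%VF \1%VF = \1%VF :> 'End(L2 R (S * T)%type).
Proof. by apply: delta_ext => -[s t]; rewrite tens_op_delta !id_lfunE delta_pair. Qed.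

Definition tpow_fun (S : finType) k (f : 'I_k -> L2 R S) : L2 R {ffun 'I_k -> S} :=
  [ffun w : {ffun 'I_k -> S} => \prod_(i < k) (f i (w i) : R[i]) : R[i]].

Lemma tpow_fun_eq (S : finType) k (f g : 'I_k -> L2 R S) : f =1 g -> tpow_fun f = tpow_fun g.
Proof. by move=> fg; apply/ffunP => w; rewrite !ffunE; apply: eq_bigr => i _; rewrite fg. Qed.

Lemma tpow_funZ (S : finType) k (f : 'I_k -> L2 R S) (a : 'I_k -> R[i]) :
  tpow_fun (fun i => a i *: f i) = (\prod_i a i) *: tpow_fun f.
Proof.
apply/ffunP => w; rewrite !ffunE -[RHS]big_split /=; apply: eq_bigr => i _.
by rewrite ffunE.
Qed.

Lemma delta_ffun (S : finType) k (s : {ffun 'I_k -> S}) :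
  delta R s = tpow_fun (fun i => delta R (s i)).
Proof.
apply/ffunP => w; rewrite !ffunE; have [->|] := eqVneq w s.
  by rewrite big1 // => i _; rewrite !ffunE eqxx.
move=> /eqP ws; have [i /eqP wi] : exists i, w i <> s i.
  by apply: contrapT => nws; apply: ws; apply/ffunP => i; apply: contrapT => wi; apply: nws; exists i.
by rewrite (bigD1 i) //= ffunE (negPf wi) mul0r.
Qed.

Lemma tpow_op_delta (S : finType) k (A : 'End(L2 R S)) (s : {ffun 'I_k -> S}) :
  tpow_op k A (delta R s) = tpow_fun (fun i => A (delta R (s i))).
Proof. by rewrite op_ofE. Qed.

Lemma tpow_opE (S : finType) k (A : 'End(L2 R S)) (f : 'I_k -> L2 R S) :
  tpow_op k A (tpow_fun f) = tpow_fun (fun i => A (f i)).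
Proof.
rewrite op_of_sum; apply/ffunP => w; rewrite sum_ffunE !ffunE.
transitivity (\prod_(i < k) \sum_(s : S) (f i s : R[i]) * (A (delta R s) (w i) : R[i])).
  rewrite bigA_distr_bigA; apply: eq_bigr => s _; rewrite !ffunE big_split /=.
  by [].
apply: eq_bigr => i _; rewrite [f i in RHS]L2_expand linear_sum sum_ffunE.
by apply: eq_bigr => s _; rewrite linearZ /= !ffunE.
Qed.

Lemma tpow_op_comp (S : finType) k (A B : 'End(L2 R S)) :
  tpow_op k (A \o B)%VF = (tpow_op k A \o tpow_op k B)%VF.
Proof.
apply: delta_ext => s.
transitivity (tpow_op k A (tpow_op k B (delta R s))); last exact/esym/comp_lfunE.
rewrite [LHS]tpow_op_delta [X in _ = tpow_op k A X]tpow_op_delta [RHS]tpow_opE.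
by apply: tpow_fun_eq => i; apply: comp_lfunE.
Qed.

Lemma tpow_op_id (S : finType) k : tpow_op k \1%VF = \1%VF :> 'End(L2 R {ffun 'I_k -> S}).
Proof.
apply: delta_ext => s; rewrite tpow_op_delta !id_lfunE delta_ffun.
by apply: tpow_fun_eq => i; rewrite id_lfunE.
Qed.

End TensorOperators.

Section WeilRep.
Variables (R : realType) (F : finFieldType) (p : nat) (pF : p \in [pchar F]).
Variables (Y Z : vectType F) (br : Z -> Y -> F).
Local Notation V := (Y * Z)%type.
Local Notation chi := (chi R pF).
Local Notation Sp := (Sp br).
Local Notation lsym := (lsym br).
Local Notation Zf := (finvect_type Z).

(** A representation of the symplectic group whose generators act as in an
    oscillator representation, on functions on any set T: b A replaces the form A,
    and act replaces the action of the inverse transpose.  The constants are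
    quantified existentially, so that tensor products stay within the notion with
    no computation of Legendre symbols or Gauss sums. *)
Record weil_rep (T : finType) (act : 'End(Y) -> 'End(Z) -> T -> T)
    (b : 'Hom(Z, Y) -> T -> T -> F) (r : 'End(V) -> 'End(L2 R T)) : Prop := WeilRep {
  weil_id : r \1%VF = \1%VF;
  weil_comp : forall S S', Sp S -> Sp S' -> r (S \o S')%VF = (r S \o r S')%VF;
  weil_N : forall A, lsym A -> forall y,
    r (opN A) (delta R y) = chi (2^-1 * b A y y) *: delta R y;
  weil_D : forall (C : 'End(Y)) (C' : 'End(Z)), lker C = 0%VS -> (forall z y, br (C' z) (C y) = br z y) ->
    exists c : R[i], forall y, r (opD C C') (delta R y) = c *: delta R (act C C' y);
  weil_J : forall B, lsym B -> lker B = 0%VS -> limg B = fullv ->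
    exists c : R[i], forall y, r (opJ B) (delta R y) = [ffun y' => c * chi (b B y y')]
}.

Lemma oscillator_weil (m : F) (mu : 'End(V) -> 'End(L2 R Zf)) :
  is_oscillator pF br m mu ->
  weil_rep (fun _ C' (z : Zf) => C' z : Zf) (fun A (z z' : Zf) => m * lbil br A z z') mu.
Proof.
case=> [[mu1 muM] muN muD muJ]; split=> //.
- by move=> A sA y; rewrite muN // omegaE mulrCA.
- by move=> C C' kC adj; exists (legendre R (lfun_det C)) => y; rewrite muD.
- move=> B sB kB iB; exists (gamma R pF br m B)^-1 => y; rewrite muJ //.
  apply/ffunP => w; rewrite !ffunE sum_ffunE (bigD1 w) //= !ffunE eqxx.
  rewrite big1 ?addr0 ?omegaE; first by congr (_ * _); exact: mulr1.
  by move=> i wi; rewrite !ffunE eq_sym (negPf wi); exact: mulr0.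
Qed.

Lemma weil_tens (T1 T2 : finType) act1 act2 b1 b2 r1 r2 :
  @weil_rep T1 act1 b1 r1 -> @weil_rep T2 act2 b2 r2 ->
  weil_rep (fun C C' (t : T1 * T2) => (act1 C C' t.1, act2 C C' t.2))
    (fun A (t t' : T1 * T2) => b1 A t.1 t'.1 + b2 A t.2 t'.2)
    (fun S => tens_op (r1 S) (r2 S)).
Proof.
move=> w1 w2; split.
- by rewrite (weil_id w1) (weil_id w2) tens_op_id.
- by move=> S S' sS sS'; rewrite (weil_comp w1) // (weil_comp w2) // tens_op_comp.
- move=> A sA [s t]; rewrite tens_op_delta (weil_N w1) // (weil_N w2) //.
  by rewrite tens_funZ -delta_pair mulrDr chiD.
- move=> C C' kC adj; have [c1 e1] := weil_D w1 kC adj; have [c2 e2] := weil_D w2 kC adj.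
  by exists (c1 * c2) => -[s t]; rewrite tens_op_delta e1 e2 tens_funZ -delta_pair.
- move=> B sB kB iB; have [c1 e1] := weil_J w1 sB kB iB; have [c2 e2] := weil_J w2 sB kB iB.
  exists (c1 * c2) => -[s t]; rewrite tens_op_delta e1 e2.
  by apply/ffunP => w; rewrite !ffunE chiD mulrACA.
Qed.

Lemma chi_big I (s : seq I) (f : I -> F) : chi (\sum_(i <- s) f i) = \prod_(i <- s) chi (f i).
Proof. by apply: (big_morph chi (chiD R pF) (chi0 R pF)). Qed.

Lemma weil_tpow (T : finType) act b r k : @weil_rep T act b r ->
  weil_rep (fun C C' (t : {ffun 'I_k -> T}) => [ffun i => act C C' (t i)])
    (fun A (t t' : {ffun 'I_k -> T}) => \sum_i b A (t i) (t' i))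
    (fun S => tpow_op k (r S)).
Proof.
move=> w; split.
- by rewrite (weil_id w) tpow_op_id.
- by move=> S S' sS sS'; rewrite (weil_comp w) // tpow_op_comp.
- move=> A sA t; rewrite tpow_op_delta mulr_sumr chi_big delta_ffun -tpow_funZ.
  by apply: tpow_fun_eq => i; rewrite (weil_N w).
- move=> C C' kC adj; have [c e] := weil_D w kC adj.
  exists (\prod_(i < k) c) => t; rewrite tpow_op_delta delta_ffun -tpow_funZ.
  by apply: tpow_fun_eq => i; rewrite e ffunE.
- move=> B sB kB iB; have [c e] := weil_J w sB kB iB.
  exists (\prod_(i < k) c) => t; rewrite tpow_op_delta.
  apply/ffunP => t'; rewrite !ffunE chi_big -big_split /=; apply: eq_bigr => i _.
  by rewrite e ffunE.
Qed.

Hypothesis pbr : perfect_pairing br.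

(** Every S in Sp has an inverse in Sp, so r S is invertible. *)
Lemma weil_inj T act b r S f : @weil_rep T act b r -> Sp S -> r S f = 0 -> f = 0.
Proof.
move=> w sS Sf; have [sS' _] := Sp_inv pbr sS.
rewrite -[f](id_lfunE) -(weil_id w) -[\1%VF](_ : (S^-1 \o S)%VF = _); last first.
  by apply/lfunP => v; rewrite comp_lfunE id_lfunE lker0_lfunK // (Sp_inj pbr sS).
by rewrite (weil_comp w) // comp_lfunE Sf linear0.
Qed.

End WeilRep.

(** * Splitting off a factor on which the Heisenberg group acts *)

Section Slices.
Variables (R : realType) (T1 T2 Z : finType) (h : T1 -> Z -> T2).
Hypothesis h_bij : bijective (fun sz : T1 * Z => h sz.1 sz.2).

Definition embed (z : Z) : 'Hom(L2 R T1, L2 R T2) := op_of (fun s => delta R (h s z)).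

Definition slice (z : Z) : 'Hom(L2 R T2, L2 R T1) :=
  linfun (fun f : L2 R T2 => [ffun s => f (h s z)] : L2 R T1).

Lemma embed_delta z s : embed z (delta R s) = delta R (h s z).
Proof. exact: op_ofE. Qed.

Lemma sliceE z (f : L2 R T2) s : slice z f s = f (h s z).
Proof. by rewrite linfunE ?ffunE // => a g g'; apply/ffunP => t; rewrite !ffunE. Qed.

Lemma h_eq s z s' z' : (h s z == h s' z') = (s == s') && (z == z').
Proof. by rewrite -xpair_eqE -(bij_eq h_bij). Qed.

Lemma h_surj t : exists s z, t = h s z.
Proof. by have [g _ gK] := h_bij; exists (g t).1, (g t).2; rewrite -[LHS]gK. Qed.

Lemma slice_embed z w f : slice z (embed w f) = if z == w then f else 0.
Proof.
rewrite [f]L2_expand !linear_sum; have [->|zw] := eqVneq z w.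
  apply: eq_bigr => s _; rewrite !linearZ /= embed_delta; congr (_ *: _).
  by apply/ffunP => s'; rewrite sliceE !ffunE h_eq eqxx andbT.
rewrite big1 // => s _; rewrite !linearZ /= embed_delta.
rewrite (_ : slice _ _ = 0) ?scaler0 //.
by apply/ffunP => s'; rewrite sliceE !ffunE h_eq (negPf zw) andbF.
Qed.

Lemma sum_embed_slice f : f = \sum_z embed z (slice z f).
Proof.
rewrite [RHS](_ : _ = (\sum_z (embed z \o slice z)%VF) f); last first.
  by rewrite sum_lfunE; apply: eq_bigr => z _; rewrite comp_lfunE.
rewrite -[LHS]id_lfunE; congr (fun_of_lfun _ _); apply: delta_ext => t.
have [s [z ->]] := h_surj t; rewrite id_lfunE sum_lfunE (bigD1 z) //= comp_lfunE -embed_delta.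
rewrite slice_embed eqxx big1 ?addr0 // => w wz.
by rewrite comp_lfunE slice_embed (negPf wz) linear0.
Qed.

Lemma embed_comb (c : Z -> R[i]) f s w : (\sum_z c z *: embed z f) (h s w) = c w * f s.
Proof. by rewrite -sliceE (sl_comb slice_embed) ffunE. Qed.

End Slices.

Section WeilTensor.
Variables (R : realType) (F : finFieldType) (p : nat) (pF : p \in [pchar F]).
Variables (Y Z : vectType F) (br : Z -> Y -> F).
Hypothesis pbr : perfect_pairing br.
Local Notation V := (Y * Z)%type.
Local Notation chi := (chi R pF).
Local Notation Sp := (Sp br).
Local Notation lsym := (lsym br).
Local Notation Zf := (finvect_type Z).

Variables (T1 T2 : finType) (s0 : T1) (h : T1 -> Zf -> T2) (d : F).
Hypothesis d0 : d != 0.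
Hypothesis h_bij : bijective (fun sz : T1 * Zf => h sz.1 sz.2).
Variables (act1 : 'End(Y) -> 'End(Z) -> T1 -> T1) (act2 : 'End(Y) -> 'End(Z) -> T2 -> T2).
Variables (b1 : 'Hom(Z, Y) -> T1 -> T1 -> F) (b2 : 'Hom(Z, Y) -> T2 -> T2 -> F).
Variables (r1 : 'End(V) -> 'End(L2 R T1)) (r2 : 'End(V) -> 'End(L2 R T2)).
Hypothesis w1 : weil_rep pF br act1 b1 r1.
Hypothesis w2 : weil_rep pF br act2 b2 r2.
Hypothesis b_split : forall A s z s' z', lsym A ->
  b2 A (h s z) (h s' z') = b1 A s s' + d * lbil br A z z'.
Hypothesis act_split : forall C (C' : 'End(Z)), lker C = 0%VS ->
  (forall z y, br (C' z) (C y) = br z y) ->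
  forall s z, act2 C C' (h s z) = h (act1 C C' s) (C' z).

Local Notation em := (embed R h).
Local Notation sl := (slice R h).

(** The operator r2 S is r1 S tensored with some operator on functions on Z. *)
Definition splits S := exists M : Zf -> Zf -> R[i], forall w f,
  r2 S (em w f) = \sum_z M z w *: em z (r1 S f).

Lemma splits_delta S (M : Zf -> Zf -> R[i]) :
  (forall w s, r2 S (delta R (h s w)) = \sum_z M z w *: em z (r1 S (delta R s))) -> splits S.
Proof.
move=> SM; exists M => w f.
rewrite [RHS](_ : _ = (\sum_z M z w *: (em z \o r1 S)%VF) f); last first.
  by rewrite sum_lfunE; apply: eq_bigr => z _; rewrite scale_lfunE comp_lfunE.
rewrite -comp_lfunE; congr (fun_of_lfun _ _); apply: delta_ext => s.
rewrite comp_lfunE embed_delta SM sum_lfunE; apply: eq_bigr => z _.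
by rewrite scale_lfunE comp_lfunE.
Qed.

Lemma splits_comp S S' : Sp S -> Sp S' -> splits S -> splits S' -> splits (S \o S')%VF.
Proof.
move=> sS sS' [M Me] [M' Me']; exists (fun z w => \sum_v M z v * M' v w) => w f.
rewrite (weil_comp w1) // (weil_comp w2) // !comp_lfunE Me' linear_sum /=.
under eq_bigr => v _ do rewrite linearZ /= Me scaler_sumr.
rewrite exchange_big; apply: eq_bigr => z _ /=.
rewrite scaler_suml; apply: eq_bigr => v _.
by rewrite scalerA mulrC.
Qed.

Lemma splits_opN A : lsym A -> splits (opN A).
Proof.
move=> sA; apply: (@splits_delta _ (fun z w => (z == w)%:R * chi (2^-1 * (d * lbil br A w w)))) => w s.
rewrite (weil_N w1) // (weil_N w2) // b_split // mulrDr chiD.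
rewrite (bigD1 w) //= eqxx mul1r big1 ?addr0 => [|z zw]; last by rewrite (negPf zw) mul0r scale0r.
by rewrite linearZ /= embed_delta scalerA mulrC.
Qed.

Lemma splits_opD C (C' : 'End(Z)) : lker C = 0%VS ->
  (forall z y, br (C' z) (C y) = br z y) -> splits (opD C C').
Proof.
move=> kC adj; have [c1 e1] := weil_D w1 kC adj; have [c2 e2] := weil_D w2 kC adj.
have c10 : c1 != 0.
  apply/eqP => c10; case/eqP: (delta_neq0 R s0).
  by apply: (weil_inj pbr w1 (Sp_opD adj)); rewrite e1 c10 scale0r.
apply: (@splits_delta _ (fun z w => (z == C' w)%:R * (c2 / c1))) => w s.
rewrite e1 e2 act_split //.
rewrite (bigD1 (C' w : Zf)) //= eqxx mul1r big1 ?addr0 => [|z zw]; last first.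
  by rewrite (negPf zw) mul0r scale0r.
by rewrite linearZ /= embed_delta scalerA divfK.
Qed.

Lemma splits_opJ B : lsym B -> lker B = 0%VS -> limg B = fullv -> splits (opJ B).
Proof.
move=> sB kB iB; have [c1 e1] := weil_J w1 sB kB iB; have [c2 e2] := weil_J w2 sB kB iB.
(* The operator r1 (opJ B) is invertible, which keeps Gauss sums out. *)
have c10 : c1 != 0.
  apply/eqP => c10; case/eqP: (delta_neq0 R s0).
  apply: (weil_inj pbr w1 (Sp_opJ pbr sB kB iB)); rewrite e1 c10.
  by apply/ffunP => t; rewrite !ffunE mul0r.
apply: (@splits_delta _ (fun z w => c2 / c1 * chi (d * lbil br B w z))) => w s.
apply/ffunP => t; have [s' [w' ->]] := h_surj h_bij t.
rewrite e1 e2 embed_comb // !ffunE b_split // chiD.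
have -> a b : c2 / c1 * a * (c1 * b) = c2 * (b * a) by rewrite mulrACA divfK // [a * b]mulrC.
by [].
Qed.

Lemma splits_Sp S : Sp S -> splits S.
Proof.
apply: (Sp_generated pbr).
- exact: splits_comp.
- exact: splits_opN.
- exact: splits_opD.
- exact: splits_opJ.
Qed.

Lemma splits_neq0 S (M : Zf -> Zf -> R[i]) : Sp S ->
  (forall w f, r2 S (em w f) = \sum_z M z w *: em z (r1 S f)) ->
  exists z w, M z w != 0.
Proof.
move=> sS Me; apply: contrapT => nM.
have M0 z w : M z w = 0 by apply: contrapT => Mz; apply: nM; exists z, w; apply/eqP.
case/eqP: (delta_neq0 R (h s0 0)); apply: (weil_inj pbr w2 sS).
by rewrite -embed_delta Me big1 // => z _; rewrite M0 scale0r.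
Qed.

Variable W : F * V -> 'End(L2 R T2).
Hypothesis W_delta : forall l x y s z,
  W (l, (x, y)) (delta R (h s z)) =
  chi (d * (2^-1 * br y x + br z x + l)) *: delta R (h s (z + y)).
Variable rho2 : F * V * 'End(V) -> 'End(L2 R T2).
Hypothesis rho2E : forall g, rho2 g = (W g.1 \o r2 g.2)%VF.

Lemma W_embed l x y z f : W (l, (x, y)) (em z f) =
  chi (d * (2^-1 * br y x + br z x + l)) *: em (z + y) f.
Proof.
rewrite -comp_lfunE -scale_lfunE; congr (fun_of_lfun _ _); apply: delta_ext => s.
by rewrite comp_lfunE scale_lfunE !embed_delta W_delta.
Qed.

(** Averaging the Weyl operators with a fixed translation part z - w against the
    characters of Y isolates the single matrix entry (z, w). *)
Lemma W_units z w : exists (I : finType) (c : I -> R[i]) (g : I -> F * V * 'End(V)),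
  (forall i, Jacobi br (g i)) /\ (forall f, em z (sl w f) = \sum_i c i *: rho2 (g i) f).
Proof.
pose y := z - w.
pose c (x : finvect_type Y) : R[i] := #|finvect_type Y|%:R^-1 *
  chi (- (d * (2^-1 * br y x + br w x))).
exists (finvect_type Y), c, (fun x => (0, (x : Y, y : Z), \1%VF)).
split=> [x|f]; first exact: Sp_id.
rewrite [RHS](_ : _ = (\sum_x c x *: rho2 (0, (x : Y, y : Z), \1%VF)) f); last first.
  by rewrite sum_lfunE; apply: eq_bigr => x _; rewrite scale_lfunE.
rewrite -comp_lfunE; congr (fun_of_lfun _ _); apply: delta_ext => t.
have [s [w' ->]] := h_surj h_bij t; rewrite comp_lfunE -embed_delta slice_embed // sum_lfunE.
have cE x : (c x *: rho2 (0, (x : Y, y : Z), \1%VF)) (em w' (delta R s)) =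
   (#|finvect_type Y|%:R^-1 * chi (d * br (w' - w) x)) *: em (w' + y) (delta R s).
  rewrite scale_lfunE rho2E /= (weil_id w2) comp_lfunE id_lfunE W_embed scalerA addr0.
  congr (_ *: _); rewrite /c -mulrA -chiD -mulrN -mulrDr; congr (_ * chi (_ * _)).
  by rewrite (brD pbr (w' : Z) (- w : Z)) (brN pbr) opprD addrACA addNr add0r addrC.
under eq_bigr => x _ do rewrite cE.
rewrite -scaler_suml -mulr_sumr; have [<-|ww'] := eqVneq w w'.
  have -> : w + y = z by rewrite /y addrC subrK.
  under eq_bigr => x _ do rewrite subrr (br0 pbr) mulr0 chi0.
  by rewrite sumr_const mulVf ?scale1r // pnatr_eq0 -lt0n; apply/card_gt0P; exists 0.
have [x0 x00] : exists x0, br (w' - w) x0 != 0 by apply: (br_neq0 pbr); rewrite subr_eq0 eq_sym.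
rewrite linear0 (@chi_sum0 _ _ _ _ _ _ x0) ?mulr0 ?scale0r ?mulf_neq0 //.
by move=> k x x'; rewrite (brDr pbr) (brZr pbr) mulrDr mulrCA.
Qed.

(** The hypotheses say that the form of the large representation is the orthogonal
    sum of that of the small one and d times the given form on Z, and that the
    Heisenberg group acts with mass d on the second summand. *)
Theorem weil_correspondence :
  correspondence (invariant_sub Sp r1) (rep_iso Sp r1)
    (invariant_sub (Jacobi br) rho2) (rep_iso (Jacobi br) rho2).
Proof.
apply: (@inflate_correspondence _ _ _ _ (0 : Zf) em sl).
- exact: slice_embed.
- exact: sum_embed_slice.
- exact: W_units.
- move=> [[l [x y]] S] /= sS; exists S => //; have [M Me] := splits_Sp sS.
  exists (fun z w => M (z - y) w * chi (d * (2^-1 * br y x + br (z - y) x + l))) => w f.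
  rewrite rho2E comp_lfunE /= Me linear_sum /=.
  rewrite [RHS](reindex_inj (addIr (y : Zf))); apply: eq_bigr => z _ /=.
  by rewrite linearZ /= W_embed addrK scalerA.
- move=> S sS; have [M Me] := splits_Sp sS; have [z [w M0]] := splits_neq0 sS Me.
  exists ((0, (0, 0)), S) => //; exists M, z, w; split=> // w' f.
  rewrite rho2E comp_lfunE /= Me linear_sum; apply: eq_bigr => z' _ /=.
  by rewrite linearZ /= W_embed !(br0r pbr) mulr0 !addr0 mulr0 chi0 scale1r.
Qed.

End WeilTensor.

(** * Oscillator representations on a tensor product with an orthogonal space *)

Section TensorModel.
Variables (F : finFieldType) (Y Z : vectType F) (br : Z -> Y -> F).
Hypothesis pbr : perfect_pairing br.
Local Notation V := (Y * Z)%type.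

(** The product Y' + Z' of U (x) Y and U (x) Z, with pure tensors e1 u x and
    e2 u z.  Pure tensors span, so identities between additive maps are checked on
    them only. *)
Record tensor_model (U Y' Z' : vectType F) (beta : U -> U -> F)
    (e1 : U -> Y -> Y') (e2 : U -> Z -> Z') (br' : Z' -> Y' -> F)
    (idt : 'End(V) -> 'End((Y' * Z')%type)) : Prop := TensorModel {
  tm_betaC : forall u v, beta u v = beta v u;
  tm_e1D : forall u x x', e1 u (x + x') = e1 u x + e1 u x';
  tm_e2D : forall u z z', e2 u (z + z') = e2 u z + e2 u z';
  tm_ind1 : forall P : Y' -> Prop, P 0 -> (forall a b, P a -> P b -> P (a + b)) ->
    (forall u x, P (e1 u x)) -> forall a, P a;
  tm_ind2 : forall P : Z' -> Prop, P 0 -> (forall a b, P a -> P b -> P (a + b)) ->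
    (forall u z, P (e2 u z)) -> forall a, P a;
  tm_brDl : forall f f' a, br' (f + f') a = br' f a + br' f' a;
  tm_brDr : forall f a a', br' f (a + a') = br' f a + br' f a';
  tm_brE : forall u u' x z, br' (e2 u' z) (e1 u x) = beta u u' * br z x;
  tm_idE : forall S u x z, idt S (e1 u x, e2 u z) = (e1 u (S (x, z)).1, e2 u (S (x, z)).2)
}.

Section Model.
Variables (U Y' Z' : vectType F) (beta : U -> U -> F).
Variables (e1 : U -> Y -> Y') (e2 : U -> Z -> Z') (br' : Z' -> Y' -> F).
Variable idt : 'End(V) -> 'End((Y' * Z')%type).
Hypothesis tm : tensor_model beta e1 e2 br' idt.
Local Notation V' := (Y' * Z')%type.

Lemma add_self0 (W : zmodType) (a : W) : a + a = a -> a = 0.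
Proof. by move/(canRL (addrK _)); rewrite subrr. Qed.

Lemma e10 u : e1 u 0 = 0.
Proof. by apply: add_self0; rewrite -(tm_e1D tm) addr0. Qed.
Lemma e20 u : e2 u 0 = 0.
Proof. by apply: add_self0; rewrite -(tm_e2D tm) addr0. Qed.
Lemma e2N u z : e2 u (- z) = - e2 u z.
Proof. by apply/eqP; rewrite -addr_eq0 -(tm_e2D tm) addNr e20. Qed.
Lemma tm_br0l a : br' 0 a = 0.
Proof. by apply: add_self0; rewrite -(tm_brDl tm) addr0. Qed.
Lemma tm_br0r f : br' f 0 = 0.
Proof. by apply: add_self0; rewrite -(tm_brDr tm) addr0. Qed.

Lemma tm_ind (P : V' -> Prop) : P 0 -> (forall w w', P w -> P w' -> P (w + w')) ->
  (forall u x z, P (e1 u x, e2 u z)) -> forall w, P w.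
Proof.
move=> P0 PD Pe [a f]; rewrite pair_split; apply: (PD).
  move: a; apply: (tm_ind1 tm) => [//|a b Pa Pb|u x].
    by rewrite (_ : (a + b, 0) = (a, 0) + (b, 0)); [exact: PD|by apply: injective_projections; rewrite /= ?addr0].
  by rewrite -(e20 u).
move: f {a}; apply: (tm_ind2 tm) => [//|a b Pa Pb|u z].
  by rewrite (_ : (0, a + b) = (0, a) + (0, b)); [exact: PD|by apply: injective_projections; rewrite /= ?addr0].
by rewrite -(e10 u).
Qed.

Lemma tm_ext (W : vectType F) (A B : 'Hom(V', W)) :
  (forall u x z, A (e1 u x, e2 u z) = B (e1 u x, e2 u z)) -> A = B.
Proof.
move=> AB; apply/lfunP; apply: tm_ind => [|w w' e e'|//]; first by rewrite !linear0.
by rewrite !linearD; congr (_ + _).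
Qed.

Lemma idt_id : idt \1%VF = \1%VF.
Proof. by apply: tm_ext => u x z; rewrite (tm_idE tm) !id_lfunE. Qed.

Lemma idt_comp S T : idt (S \o T)%VF = (idt S \o idt T)%VF.
Proof.
apply: tm_ext => u x z; rewrite comp_lfunE !(tm_idE tm) comp_lfunE.
by rewrite -surjective_pairing.
Qed.

(** The block entries of idt S, read off on the two coordinate summands: this
    extends the operators A, C, G to the tensor product without choosing a basis. *)
Definition lift_N (A : 'Hom(Z, Y)) : 'Hom(Z', Y') :=
  linfun (fun f => (idt (opN A) (0, f)).1).
Definition lift_Z (C : 'End(Z)) : 'End(Z') :=
  linfun (fun f => (idt (opD 0 C) (0, f)).2).
Definition lift_Y (C : 'End(Y)) : 'End(Y') :=
  linfun (fun a => (idt (opD C 0) (a, 0)).1).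
Definition lift_L (G : 'Hom(Y, Z)) : 'Hom(Y', Z') :=
  linfun (fun a => (idt (linfun (fun v : V => (0, G v.1))) (a, 0)).2).

Lemma linear_inr (W : vectType F) (S : 'Hom(V', W)) : linear (fun f => S (0, f)).
Proof. by move=> k f f'; rewrite -linearP -pairDz. Qed.
Lemma linear_inl (W : vectType F) (S : 'Hom(V', W)) : linear (fun a => S (a, 0)).
Proof. by move=> k a a'; rewrite -linearP -pairDx. Qed.

Lemma lift_NE A u z : lift_N A (e2 u z) = e1 u (A z).
Proof.
rewrite linfunE => [|k f f']; last by rewrite linear_inr.
by rewrite -(e10 u) (tm_idE tm) opNE /= add0r.
Qed.

Lemma lift_ZE C u z : lift_Z C (e2 u z) = e2 u (C z).
Proof.
rewrite linfunE => [|k f f']; last by rewrite linear_inr.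
by rewrite -(e10 u) (tm_idE tm) opDE.
Qed.

Lemma lift_YE C u x : lift_Y C (e1 u x) = e1 u (C x).
Proof.
rewrite linfunE => [|k f f']; last by rewrite linear_inl.
by rewrite -(e20 u) (tm_idE tm) opDE.
Qed.

Lemma lift_LE G u x : lift_L G (e1 u x) = e2 u (G x).
Proof.
rewrite linfunE => [|k f f']; last by rewrite linear_inl.
rewrite -(e20 u) (tm_idE tm) linfunE // => k [x1 z1] [x2 z2].
by congr (_, _); rewrite /= ?scaler0 ?addr0 ?linearP.
Qed.

Lemma ext1 (W : vectType F) (A B : 'Hom(Y', W)) :
  (forall u x, A (e1 u x) = B (e1 u x)) -> A = B.
Proof.
move=> AB; apply/lfunP; apply: (tm_ind1 tm) => [|w w' e e'|//]; first by rewrite !linear0.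
by rewrite !linearD; congr (_ + _).
Qed.

Lemma ext2 (W : vectType F) (A B : 'Hom(Z', W)) :
  (forall u x, A (e2 u x) = B (e2 u x)) -> A = B.
Proof.
move=> AB; apply/lfunP; apply: (tm_ind2 tm) => [|w w' e e'|//]; first by rewrite !linear0.
by rewrite !linearD; congr (_ + _).
Qed.

Lemma idt_opN A : idt (opN A) = opN (lift_N A).
Proof.
apply: tm_ext => u x z; rewrite (tm_idE tm) !opNE /= lift_NE.
by rewrite (tm_e1D tm).
Qed.

Lemma idt_opD C C' : idt (opD C C') = opD (lift_Y C) (lift_Z C').
Proof. by apply: tm_ext => u x z; rewrite (tm_idE tm) !opDE /= lift_YE lift_ZE. Qed.

Lemma lift_Y_ker C : lker C = 0%VS -> lker (lift_Y C) = 0%VS.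
Proof.
move=> kC; have CK : cancel C (C^-1)%VF by apply: lker0_lfunK; rewrite kC.
have e : (lift_Y C^-1 \o lift_Y C)%VF = \1%VF.
  by apply: ext1 => u x; rewrite comp_lfunE !lift_YE CK id_lfunE.
apply/eqP; rewrite -subv0; apply/subvP => a; rewrite memv_ker memv0 => /eqP Ca.
by rewrite -[a]id_lfunE -e comp_lfunE Ca linear0.
Qed.

Section LiftJ.
Variable B : 'Hom(Z, Y).
Hypotheses (kB : lker B = 0%VS) (iB : limg B = fullv).

Lemma lift_NK : cancel (lift_N B) (lift_L B^-1).
Proof.
have KB : cancel B (B^-1)%VF by apply: lker0_lfunK; rewrite kB.
suff e : (lift_L B^-1 \o lift_N B)%VF = \1%VF.
  by move=> f; rewrite -comp_lfunE e id_lfunE.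
by apply: ext2 => u z; rewrite comp_lfunE lift_NE lift_LE KB id_lfunE.
Qed.

Lemma lift_NVK : cancel (lift_L B^-1) (lift_N B).
Proof.
have BK y : B ((B^-1)%VF y) = y by rewrite limg_lfunVK // iB memvf.
suff e : (lift_N B \o lift_L B^-1)%VF = \1%VF.
  by move=> f; rewrite -comp_lfunE e id_lfunE.
by apply: ext1 => u x; rewrite comp_lfunE lift_LE lift_NE BK id_lfunE.
Qed.

Lemma lift_N_ker : lker (lift_N B) = 0%VS.
Proof.
apply/eqP; rewrite -subv0; apply/subvP => f; rewrite memv_ker memv0 => /eqP Bf.
by rewrite -[f]lift_NK Bf linear0.
Qed.

Lemma lift_N_img : limg (lift_N B) = fullv.
Proof.
apply/eqP; rewrite eqEsubv subvf /=; apply/subvP => a _; apply/memv_imgP.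
by exists (lift_L B^-1 a); rewrite ?memvf // lift_NVK.
Qed.

Lemma idt_opJ : idt (opJ B) = opJ (lift_N B).
Proof.
have inv a : ((lift_N B)^-1)%VF a = lift_L (B^-1)%VF a.
  by rewrite -{1}[a]lift_NVK lker0_lfunK // lift_N_ker.
apply: tm_ext => u x z; rewrite (tm_idE tm) !opJE /= lift_NE inv lift_LE.
by rewrite e2N.
Qed.

End LiftJ.

Lemma Sp_idt S : Sp br S -> Sp br' (idt S).
Proof.
move=> sS; have formD w w' w'' : symp_form br' (w + w') w'' = symp_form br' w w'' + symp_form br' w' w''.
  by rewrite /symp_form /= (tm_brDl tm) (tm_brDr tm) opprD addrACA.
have formDr w w' w'' : symp_form br' w (w' + w'') = symp_form br' w w' + symp_form br' w w''.
  by rewrite /symp_form /= (tm_brDl tm) (tm_brDr tm) opprD addrACA.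
have form0 w : symp_form br' 0 w = 0 by rewrite /symp_form /= tm_br0l tm_br0r subrr.
have form0r w : symp_form br' w 0 = 0 by rewrite /symp_form /= tm_br0l tm_br0r subrr.
have form_e u u' x z x' z' : symp_form br' (e1 u x, e2 u z) (e1 u' x', e2 u' z') =
    beta u u' * symp_form br (x, z) (x', z').
  by rewrite /symp_form /= !(tm_brE tm) (tm_betaC tm u') mulrBr.
apply: tm_ind => [|w1 w2 E1 E2|u x z].
- by move=> w; rewrite linear0 !form0.
- by move=> w; rewrite linearD !formD E1 E2.
apply: tm_ind => [|w1 w2 E1 E2|u' x' z']; first by rewrite linear0 !form0r.
  by rewrite linearD !formDr E1 E2.
by rewrite !(tm_idE tm) !form_e -!surjective_pairing sS.
Qed.

(** The shear by an operator is symplectic exactly when the operator is symmetric. *)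
Lemma lsym_lift A : lsym br A -> lsym br' (lift_N A).
Proof.
move=> sA f f'; have := Sp_idt (Sp_opN pbr sA) (0, f) (0, f').
rewrite idt_opN !opNE /symp_form /= !add0r !tm_br0r subrr.
by move/eqP; rewrite subr_eq0 => /eqP.
Qed.

Variables (R : realType) (p : nat) (pF : p \in [pchar F]).

(** Restricting to Sp(V) sends each generator to a generator of the same kind. *)
Lemma weil_idt (mu : 'End(V') -> 'End(L2 R (finvect_type Z'))) :
  is_oscillator pF br' 1 mu ->
  weil_rep pF br (fun _ C' (f : finvect_type Z') => lift_Z C' f : finvect_type Z')
    (fun A (f f' : finvect_type Z') => br' f' (lift_N A f)) (fun S => mu (idt S)).
Proof.
move=> /oscillator_weil w; split.
- by rewrite idt_id (weil_id w).
- by move=> S S' sS sS'; rewrite idt_comp (weil_comp w) //; apply: Sp_idt.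
- move=> A sA f; rewrite idt_opN (weil_N w); last exact: lsym_lift.
  by rewrite mul1r.
- move=> C C' kC adj; have := @weil_D _ _ _ _ _ _ _ _ _ _ _ w (lift_Y C) (lift_Z C').
  case=> [||c e].
  + exact: lift_Y_ker.
  + move=> f a; have := Sp_idt (Sp_opD adj) (a, 0) (0, f).
    by rewrite idt_opD !opDE /symp_form /= !linear0 !tm_br0l !subr0.
  + by exists c => f; rewrite idt_opD e.
- move=> B sB kB iB; have [] := weil_J w (lsym_lift sB).
  + exact: lift_N_ker.
  + exact: lift_N_img.
  + move=> c e; exists c => f; rewrite idt_opJ // e; apply/ffunP => f'.
    by rewrite !ffunE mul1r.
Qed.

End Model.
End TensorModel.

(** * Splitting off a non-isotropic vector *)

Section OrthogonalSplitting.
Variables (R : realType) (F : finFieldType) (p : nat) (pF : p \in [pchar F]).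
Variables (Y Z : vectType F) (br : Z -> Y -> F).
Hypothesis pbr : perfect_pairing br.
Local Notation V := (Y * Z)%type.
Variables (U1 Y1 Z1 : vectType F) (beta1 : U1 -> U1 -> F) (e11 : U1 -> Y -> Y1)
  (e12 : U1 -> Z -> Z1) (br1 : Z1 -> Y1 -> F) (idt1 : 'End(V) -> 'End((Y1 * Z1)%type)).
Variables (U2 Y2 Z2 : vectType F) (beta2 : U2 -> U2 -> F) (e21 : U2 -> Y -> Y2)
  (e22 : U2 -> Z -> Z2) (br2 : Z2 -> Y2 -> F) (idt2 : 'End(V) -> 'End((Y2 * Z2)%type)).
Hypothesis tm1 : tensor_model br beta1 e11 e12 br1 idt1.
Hypothesis tm2 : tensor_model br beta2 e21 e22 br2 idt2.
Variables (j : U1 -> U2) (inc : 'Hom(Z1, Z2)) (u : U2).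
Hypothesis incE : forall v z, inc (e12 v z) = e22 (j v) z.
Hypothesis j_isom : forall v v', beta2 (j v) (j v') = beta1 v v'.
Hypothesis j_orth : forall v, beta2 u (j v) = 0.
Hypothesis u0 : beta2 u u != 0.

Local Notation Z1f := (finvect_type Z1).
Local Notation Z2f := (finvect_type Z2).
Local Notation Zf := (finvect_type Z).

(** The space U2 is the orthogonal sum of the image of U1 and the line of u; an
    element of U2 (x) Z is assembled from its components s over U1 and z along u. *)
Definition glue (s : Z1f) (z : Zf) : Z2f := inc s + e22 u z.
Hypothesis glue_bij : bijective (fun sz : Z1f * Zf => glue sz.1 sz.2).

(** The cross terms vanish because u is orthogonal to the image of U1. *)
Lemma glue_form A s z s' z' :
  br2 (glue s' z') (lift_N idt2 A (glue s z)) =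
  br1 s' (lift_N idt1 A s) + beta2 u u * lbil br A z z'.
Proof.
have j_orth' v : beta2 (j v) u = 0 by rewrite (tm_betaC tm2).
have inc_inc f f' : br2 (inc f') (lift_N idt2 A (inc f)) = br1 f' (lift_N idt1 A f).
  move: f f'; apply: (tm_ind2 tm1) => [|a b ea eb|v w] f'.
  - by rewrite !linear0 (tm_br0r tm1) (tm_br0r tm2).
  - by rewrite !linearD (tm_brDr tm1) (tm_brDr tm2) ea eb.
  move: f'; apply: (tm_ind2 tm1) => [|a b ea eb|v' w'].
  - by rewrite linear0 (tm_br0l tm1) (tm_br0l tm2).
  - by rewrite linearD (tm_brDl tm1) (tm_brDl tm2) ea eb.
  by rewrite !incE (lift_NE tm2) (lift_NE tm1) (tm_brE tm1) (tm_brE tm2) j_isom.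
have u_inc f : br2 (e22 u z') (lift_N idt2 A (inc f)) = 0.
  move: f; apply: (tm_ind2 tm1) => [|a b ea eb|v w].
  - by rewrite !linear0 (tm_br0r tm2).
  - by rewrite !linearD (tm_brDr tm2) ea eb addr0.
  by rewrite incE (lift_NE tm2) (tm_brE tm2) j_orth' mul0r.
have inc_u f x : br2 (inc f) (e21 u x) = 0.
  move: f; apply: (tm_ind2 tm1) => [|a b ea eb|v w].
  - by rewrite linear0 (tm_br0l tm2).
  - by rewrite linearD (tm_brDl tm2) ea eb addr0.
  by rewrite incE (tm_brE tm2) j_orth mul0r.
rewrite /glue linearD /= (lift_NE tm2) (tm_brDl tm2) !(tm_brDr tm2).
by rewrite inc_inc inc_u u_inc (tm_brE tm2) addr0 add0r.
Qed.

Lemma glue_lift C s z : lift_Z idt2 C (glue s z) = glue (lift_Z idt1 C s) (C z).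
Proof.
rewrite /glue linearD /= (lift_ZE tm2); congr (_ + _).
rewrite -!comp_lfunE; congr (fun_of_lfun _ _); apply: (ext2 tm1) => v w.
by rewrite !comp_lfunE incE (lift_ZE tm2) (lift_ZE tm1) incE.
Qed.

Lemma glue_pair x s z : br2 (glue s z) (e21 u x) = beta2 u u * br z x.
Proof.
rewrite /glue (tm_brDl tm2) (tm_brE tm2) -[RHS]add0r; congr (_ + _).
move: (s : Z1); apply: (tm_ind2 tm1) => [|a b ea eb|v w].
- by rewrite linear0 (tm_br0l tm2).
- by rewrite linearD (tm_brDl tm2) ea eb addr0.
by rewrite incE (tm_brE tm2) j_orth mul0r.
Qed.

Variables (mu1 : 'End((Y1 * Z1)%type) -> 'End(L2 R Z1f)).
Variables (mu2 : 'End((Y2 * Z2)%type) -> 'End(L2 R Z2f)).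
Hypothesis osc1 : is_oscillator pF br1 1 mu1.
Hypothesis osc2 : is_oscillator pF br2 1 mu2.
Variable rho2 : F * V * 'End(V) -> 'End(L2 R Z2f).
Hypothesis rho2E : forall g, rho2 g =
  (weyl R pF br2 1 (beta2 u u * g.1.1, (e21 u g.1.2.1, e22 u g.1.2.2)) \o mu2 (idt2 g.2))%VF.

Theorem splitting_correspondence :
  correspondence (invariant_sub (Sp br) (fun S => mu1 (idt1 S)))
    (rep_iso (Sp br) (fun S => mu1 (idt1 S)))
    (invariant_sub (Jacobi br) rho2) (rep_iso (Jacobi br) rho2).
Proof.
apply: (@weil_correspondence R F p pF Y Z br pbr Z1f Z2f 0 glue (beta2 u u) u0 glue_bij
  _ _ _ _ _ _ (weil_idt pbr tm1 osc1) (weil_idt pbr tm2 osc2) _ _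
  (fun g => weyl R pF br2 1 (beta2 u u * g.1, (e21 u g.2.1, e22 u g.2.2)))).
- by move=> A s z s' z' _; apply: glue_form.
- by move=> C C' _ _ s z; apply: glue_lift.
- move=> l x y s z; rewrite op_ofE /= omegaE mul1r; congr (chi _ _ _ *: delta R _).
    by rewrite (tm_brE tm2) glue_pair mulrCA -!mulrDr.
  by rewrite /glue (tm_e2D tm2) addrA.
- exact: rho2E.
Qed.

End OrthogonalSplitting.

(** * Spaces of homomorphisms *)

Section ConcreteModel.
Variables (F : finFieldType) (U X : vectType F).
Local Notation Xd := (dualv X).

Definition tens1 (u : U) (x : X) : 'Hom(Xd, U) := (tens u (x, 0)).1.
Definition tens2 (u : U) (z : Xd) : 'Hom(X, U) := (tens u (0, z)).2.

Lemma tens1E u x (z : Xd) : tens1 u x z = ev z x *: u.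
Proof. exact: (tensE1 u (x, 0)). Qed.

Lemma tens2E u (z : Xd) x : tens2 u z x = ev z x *: u.
Proof. exact: (tensE2 u (0, z)). Qed.

Lemma tens1_expand (a : 'Hom(Xd, U)) :
  a = \sum_(j < \dim {:X}) tens1 (a (dual_basis j)) (vbasis {:X})`_j.
Proof.
apply/lfunP => z; rewrite sum_lfunE.
have zE : z = \sum_(j < \dim {:X}) ev z (vbasis {:X})`_j *: dual_basis j.
  apply: ev_inj => x; rewrite -dual_basis_sum /ev sum_lfunE; apply: eq_bigr => j _.
  by rewrite scale_lfunE; apply: mulrC.
rewrite {1}zE linear_sum; apply: eq_bigr => j _.
by rewrite tens1E linearZ.
Qed.

Lemma tens2_expand (f : 'Hom(X, U)) :
  f = \sum_(j < \dim {:X}) tens2 (f (vbasis {:X})`_j) (dual_basis j).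
Proof.
apply/lfunP => x; rewrite sum_lfunE {1}(coord_vbasis (memvf x)) linear_sum.
by apply: eq_bigr => j _; rewrite tens2E linearZ coord_ev.
Qed.

Variable beta : U -> U -> F.
Hypothesis betaDl : forall a b c, beta (a + b) c = beta a c + beta b c.
Hypothesis betaZl : forall k a b, beta (k *: a) b = k * beta a b.
Hypothesis betaC : forall a b, beta a b = beta b a.

Lemma hom_tensor_model : tensor_model (@ev F X) beta tens1 tens2
  (@tens_br F U X beta) (@id_tens F U X).
Proof.
have betaDr a b c : beta a (b + c) = beta a b + beta a c by rewrite ![beta a _]betaC betaDl.
have betaZr k a b : beta a (k *: b) = k * beta a b by rewrite ![beta a _]betaC betaZl.
split=> //.
- by move=> u x x'; apply/lfunP => z; rewrite add_lfunE !tens1E evDr scalerDl.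
- by move=> u z z'; apply/lfunP => x; rewrite add_lfunE !tens2E evD scalerDl.
- by move=> P P0 PD Pe a; rewrite [a]tens1_expand; apply: big_ind.
- by move=> P P0 PD Pe f; rewrite [f]tens2_expand; apply: big_ind.
- by move=> f f' a; rewrite -big_split; apply: eq_bigr => j _; rewrite add_lfunE betaDr.
- by move=> f a a'; rewrite -big_split; apply: eq_bigr => j _; rewrite add_lfunE betaDl.
- move=> u u' x z; rewrite -(dual_basis_sum z x) mulr_sumr; apply: eq_bigr => j _.
  by rewrite tens1E tens2E betaZl betaZr mulrA [RHS]mulrC.
- move=> S u x z; rewrite -[(_, _) in LHS]/(tens u (x, z)) id_tensE.
  by case: (S (x, z)).
Qed.

End ConcreteModel.

Section OrthogonalComplement.
Variables (R : realType) (F : finFieldType) (p : nat) (pF : p \in [pchar F]).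
Variables (X U : vectType F) (beta : {symmetric U}) (u : U).
Hypothesis u0 : beta u u != 0.
Local Notation U' := (subvs_of (orthov beta <[u]>)).
Local Notation Xd := (dualv X).
Let beta' (a b : U') := beta (vsval a) (vsval b).

Lemma symmetric_formC a b : beta a b = beta b a.
Proof. by rewrite (hermC beta) expr0 mul1r. Qed.

Lemma orth_subvs (a : U') : beta u (vsval a) = 0.
Proof. by rewrite symmetric_formC; apply/eqP; rewrite -mem_orthov1 subvsP. Qed.

Definition incl : 'Hom(U', U) := linfun vsval.
Definition incl_hom : 'Hom('Hom(X, U'), 'Hom(X, U)) := linfun (fun s : 'Hom(X, U') => (incl \o s)%VF).

Lemma inclE a : incl a = vsval a.
Proof. exact: lfunE. Qed.

Lemma incl_homE s : incl_hom s = (incl \o s)%VF.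
Proof.
rewrite linfunE // => k a b; apply/lfunP => x.
by rewrite !(comp_lfunE, add_lfunE, scale_lfunE) linearP.
Qed.

Definition coef : 'Hom(U, F^o) := linfun (fun a => beta a u / beta u u : F^o).
Definition proj : 'Hom(U, U') := linfun (fun a => vsproj (orthov beta <[u]>) (a - coef a *: u)).

Lemma coefE a : coef a = beta a u / beta u u.
Proof.
rewrite linfunE // => k b c.
by rewrite linearPl /= mulrDl -mulrA.
Qed.

Lemma projE a : vsval (proj a) = a - coef a *: u.
Proof.
rewrite linfunE => [|k b c].
  rewrite vsprojK // mem_orthov1 linearBl linearZl_LR /= coefE.
  by rewrite divfK // subrr.
rewrite -linearP; congr (vsproj _ _).
by rewrite linearP /= scalerDl -scalerA scalerBr opprD addrACA.
Qed.

Lemma hom_glue_bij : bijective (fun sz : finvect_type 'Hom(X, U') * finvect_type Xd =>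
  glue (@tens2 F U X) incl_hom u sz.1 sz.2 : finvect_type 'Hom(X, U)).
Proof.
have gE s z x : glue (@tens2 F U X) incl_hom u s z x = vsval (s x) + ev z x *: u.
  by rewrite /glue incl_homE add_lfunE comp_lfunE inclE tens2E.
pose g (f : finvect_type 'Hom(X, U)) : finvect_type 'Hom(X, U') * finvect_type Xd :=
  ((proj \o f)%VF, (coef \o f)%VF : Xd).
exists g => [[s z]|f].
  have cE x : coef (glue (@tens2 F U X) incl_hom u s z x) = ev z x.
    rewrite coefE gE linearDl linearZl_LR /= symmetric_formC orth_subvs add0r.
    by rewrite mulfK.
  congr (_, _); apply/lfunP => x /=; rewrite comp_lfunE ?cE //.
  by apply: subvs_inj; rewrite projE cE gE addrK.
by apply/lfunP => x; rewrite gE !comp_lfunE projE /ev comp_lfunE subrK.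
Qed.

Theorem orthov_correspondence
    (muU : 'End(('Hom(Xd, U) * 'Hom(X, U))%type) -> 'End(L2 R (finvect_type 'Hom(X, U))))
    (muU' : 'End(('Hom(Xd, U') * 'Hom(X, U'))%type) -> 'End(L2 R (finvect_type 'Hom(X, U')))) :
  is_oscillator pF (tens_br beta) 1 muU -> is_oscillator pF (tens_br beta') 1 muU' ->
  let rho1 := fun S : 'End((X * Xd)%type) => muU' (id_tens U' S) in
  let rho2 := clifford_u pF beta u muU in
  let D1 := Sp (@ev F X) in
  let D2 := Jacobi (@ev F X) in
  correspondence (invariant_sub D1 rho1) (rep_iso D1 rho1)
                 (invariant_sub D2 rho2) (rep_iso D2 rho2).
Proof.
move=> osc osc'.
have betaDl a b c : beta (a + b) c = beta a c + beta b c by rewrite linearDl.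
have betaZl k a b : beta (k *: a) b = k * beta a b by rewrite linearZl_LR.
have tm := hom_tensor_model X betaDl betaZl symmetric_formC.
have tm' : tensor_model (@ev F X) beta' (@tens1 F U' X) (@tens2 F U' X)
    (tens_br beta') (@id_tens F U' X).
  by apply: hom_tensor_model => *; rewrite /beta' ?linearDl ?linearZl_LR //= symmetric_formC.
apply: (splitting_correspondence (j := fun v : U' => vsval v) (ev_perfect X) tm' tm _ _ _ u0 hom_glue_bij osc' osc).
- move=> v z; apply/lfunP => x.
  by rewrite incl_homE comp_lfunE inclE !tens2E linearZ.
- by [].
- exact: orth_subvs.
- by [].
Qed.

End OrthogonalComplement.

(** * Orthogonal frames and tensor powers *)

Section Frame.
Variable F : finFieldType.

(** Counting: a square has at most two roots and 0 only one, so more than half of the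
    field are squares, and the sets of all a^2 and of all t - b^2 must meet. *)
Lemma sum_two_squares (t : F) : exists a b : F, a ^+ 2 + b ^+ 2 = t.
Proof.
pose Q := [set a ^+ 2 | a : F]%SET.
have cQ : (#|F| < 2 * #|Q|)%N.
  have cF : (#|[set: F]%SET| <= \sum_(y in Q) #|[set x : F | x ^+ 2 == y]%SET|)%N.
    rewrite -sum1_card (partition_big (fun x : F => x ^+ 2) [in Q]) /=; last first.
      by move=> x _; apply: imset_f.
    apply: leq_sum => y _; rewrite -sum1_card; apply/eq_leq/eq_bigl => x.
    by rewrite !inE.
  have Q0 : 0 \in Q by apply/imsetP; exists 0; rewrite ?expr0n.
  rewrite -cardsT; apply: leq_ltn_trans cF _; rewrite (bigD1 0) //=.
  have c0 : #|[set x : F | x ^+ 2 == 0]%SET| = 1%N.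
    by apply/eqP/cards1P; exists 0; apply/setP => x; rewrite !inE sqrf_eq0.
  have c2 y : y \in Q -> (#|[set x : F | x ^+ 2 == y]%SET| <= 2)%N.
    case/imsetP => a _ ->; apply: leq_trans (_ : #|[set a; - a]%SET| <= 2)%N.
      by apply/subset_leq_card/fintype.subsetP => x; rewrite !inE eqf_sqr.
    by rewrite cards2; case: eqP.
  have S : (\sum_(y in Q | y != 0%R) #|[set x : F | x ^+ 2 == y]%SET| <= 2 * #|Q :\ 0%R|)%N.
    rewrite mulnC -sum_nat_const.
    rewrite [leqRHS](eq_bigl [pred y | (y \in Q) && (y != 0)]) => [|y]; last by rewrite !inE andbC.
    by apply: leq_sum => y /andP[yQ _]; apply: c2.
  by rewrite c0 (cardsD1 0 Q) Q0 mulnDr muln1 add1n add2n !ltnS.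
pose Q' := [set t - y | y in Q]%SET.
have cQ' : #|Q'| = #|Q| by rewrite card_imset // => x y /(canRL (subKr t)) ->; rewrite subKr.
have : (Q :&: Q' != finset.set0)%SET.
  apply: contraTneq cQ => QQ0; rewrite -leqNgt mul2n -addnn -{2}cQ'.
  by rewrite -cardsUI QQ0 cards0 addn0 max_card.
case/set0Pn => y; rewrite inE => /andP[/imsetP[a _ ->] /imsetP[_ /imsetP[b _ ->] ab]].
by exists a, b; rewrite ab subrK.
Qed.

Variable n : nat.
Implicit Types v w e u : 'rV[F]_n.
Definition dot v w := \sum_i v 0 i * w 0 i.

Lemma dotC v w : dot v w = dot w v.
Proof. by apply: eq_bigr => i _; rewrite mulrC. Qed.
Lemma dotDl v v' w : dot (v + v') w = dot v w + dot v' w.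
Proof. by rewrite -big_split; apply: eq_bigr => i _; rewrite mxE mulrDl. Qed.
Lemma dotZl a v w : dot (a *: v) w = a * dot v w.
Proof. by rewrite mulr_sumr; apply: eq_bigr => i _; rewrite mxE mulrA. Qed.
Lemma dotDr v w w' : dot v (w + w') = dot v w + dot v w'.
Proof. by rewrite dotC dotDl ![dot _ v]dotC. Qed.
Lemma dotZr a v w : dot v (a *: w) = a * dot v w.
Proof. by rewrite dotC dotZl dotC. Qed.
Lemma dotNl v w : dot (- v) w = - dot v w.
Proof. by rewrite -scaleN1r dotZl mulN1r. Qed.
Lemma dotNr v w : dot v (- w) = - dot v w.
Proof. by rewrite dotC dotNl dotC. Qed.

Definition reflection r v := v - (2 * dot v r / dot r r) *: r.

Lemma reflection_isometry r v w : dot r r != 0 ->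
  dot (reflection r v) (reflection r w) = dot v w.
Proof.
move=> r0; rewrite /reflection !(dotDl, dotDr, dotNl, dotNr, dotZl, dotZr) [dot r w]dotC.
by field.
Qed.

(** The reflections along e - u and along e + u carry e to u and to -u.  At least
    one of these vectors is not isotropic, as their norms add up to 4 times that
    of e. *)
Lemma isometry_transitive e u : 2%:R != 0 :> F -> dot e e = dot u u -> dot e e != 0 ->
  exists s : 'rV[F]_n -> 'rV[F]_n, (forall v w, dot (s v) (s w) = dot v w) /\ s e = u.
Proof.
move=> two0 eu e0; have [ue|ue] := eqVneq (dot (e - u) (e - u)) 0.
  have d4 : dot (e + u) (e + u) = 2 * (2 * dot e e).
    have : dot (e + u) (e + u) + dot (e - u) (e - u) = 2 * (2 * dot e e).
      by rewrite !(dotDl, dotDr, dotNl, dotNr) -eu [dot u e]dotC; ring.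
    by rewrite ue addr0.
  have d40 : dot (e + u) (e + u) != 0 by rewrite d4 !mulf_neq0.
  exists (fun v => - reflection (e + u) v); split=> [v w|].
    by rewrite dotNl dotNr opprK reflection_isometry.
  have -> : reflection (e + u) e = e - 1 *: (e + u).
    rewrite /reflection; congr (_ - _ *: _).
    have -> : 2 * dot e (e + u) = dot (e + u) (e + u); last by rewrite divff.
    by rewrite !(dotDl, dotDr) -eu [dot u e]dotC; ring.
  by rewrite scale1r opprB addrC addKr.
exists (reflection (e - u)); split=> [v w|]; first by rewrite reflection_isometry.
have -> : reflection (e - u) e = e - 1 *: (e - u).
  rewrite /reflection; congr (_ - _ *: _).
  have -> : 2 * dot e (e - u) = dot (e - u) (e - u); last by rewrite divff.
  by rewrite !(dotDl, dotDr, dotNl, dotNr) -eu [dot u e]dotC; ring.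
by rewrite scale1r opprB addrC subrK.
Qed.

End Frame.

(** The vectors P j, q and (1, .., 1), of norms 1, t and t, are the images of the
    coordinate vectors and of f and e below under an isometry that carries e to
    (1, .., 1). *)
Lemma orthogonal_frame (F : finFieldType) (k : nat) : 2%:R != 0 :> F -> (k + 2)%:R != 0 :> F ->
  exists (P : 'I_k -> 'I_(k + 2) -> F) (q : 'I_(k + 2) -> F),
  [/\ forall j j', \sum_i P j i * P j' i = (j == j')%:R,
      forall j, \sum_i P j i * q i = 0,
      \sum_i q i * q i = (k + 2)%:R,
      forall j, \sum_i P j i = 0 &
      \sum_i q i = 0].
Proof.
move=> two0 t0; set t : F := (k + 2)%:R in t0 *.
have [a [b ab]] := sum_two_squares t.
pose r2 (x y : F) : 'rV[F]_2 := \row_i (if i == 0 then x else y).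
pose E (j : 'I_k) : 'rV[F]_(k + 2) := row_mx (delta_mx 0 j) 0.
pose f : 'rV[F]_(k + 2) := row_mx 0 (r2 (- b) a).
pose e : 'rV[F]_(k + 2) := row_mx 0 (r2 a b).
pose u : 'rV[F]_(k + 2) := const_mx 1.
have dot_row (x x' : 'rV[F]_k) (y y' : 'rV[F]_2) :
    dot (row_mx x y) (row_mx x' y') = dot x x' + dot y y'.
  rewrite /dot big_split_ord; congr (_ + _); apply: eq_bigr => i _.
    by rewrite !row_mxEl.
  by rewrite !row_mxEr.
have dot0 m (x : 'rV[F]_m) : dot 0 x = 0 by apply: big1 => i _; rewrite mxE mul0r.
have dotr0 m (x : 'rV[F]_m) : dot x 0 = 0 by rewrite dotC dot0.
have dot2 x y x' y' : dot (r2 x y) (r2 x' y') = x * x' + y * y'.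
  by rewrite /dot !big_ord_recl big_ord0 !mxE /= addr0.
have dotE j j' : dot (E j) (E j') = (j == j')%:R.
  rewrite dot_row dot0 addr0 /dot (bigD1 j) //= !mxE !eqxx mul1r big1 ?addr0 // => i ij.
  by rewrite !mxE eqxx (negPf ij) mul0r.
have dotEf j : dot (E j) f = 0 by rewrite dot_row dot0 dotr0 addr0.
have dotEe j : dot (E j) e = 0 by rewrite dot_row dot0 dotr0 addr0.
have dotff : dot f f = t by rewrite dot_row dot0 add0r dot2 -ab; ring.
have dotfe : dot f e = 0 by rewrite dot_row dot0 add0r dot2; ring.
have dotee : dot e e = t by rewrite dot_row dot0 add0r dot2 -ab; ring.
have dotuu : dot u u = t.
  rewrite /dot; under eq_bigr => i _ do rewrite !mxE mul1r.
  by rewrite sumr_const card_ord.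
have [||s [s_iso se]] := isometry_transitive two0 (e := e) (u := u); rewrite ?dotee ?dotuu //.
have dotu v : dot v u = \sum_i v 0 i by apply: eq_bigr => i _; rewrite mxE mulr1.
exists (fun j i => s (E j) 0 i), (fun i => s f 0 i); split.
- by move=> j j'; rewrite -[LHS]/(dot _ _) s_iso.
- by move=> j; rewrite -[LHS]/(dot _ _) s_iso.
- by rewrite -[LHS]/(dot _ _) s_iso.
- by move=> j; rewrite -dotu -se s_iso.
- by rewrite -dotu -se s_iso.
Qed.

Section TensorPowers.
Variables (R : realType) (F : finFieldType) (p : nat) (pF : p \in [pchar F]).
Variables (Y Z : vectType F) (br : Z -> Y -> F).
Hypothesis pbr : perfect_pairing br.
Local Notation V := (Y * Z)%type.
Local Notation Zf := (finvect_type Z).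
Variable k : nat.
Local Notation t := ((k + 2)%N%:R : F).
Hypothesis t0 : t != 0.

Variables (P : 'I_k -> 'I_(k + 2) -> F) (q : 'I_(k + 2) -> F).
Hypothesis PP : forall j j', \sum_i P j i * P j' i = (j == j')%:R.
Hypothesis Pq : forall j, \sum_i P j i * q i = 0.
Hypothesis qq : \sum_i q i * q i = t.
Hypothesis P1 : forall j, \sum_i P j i = 0.
Hypothesis q1 : \sum_i q i = 0.

(** The element of F^t (x) Z whose coordinates in the orthogonal basis are the
    entries of ys and z. *)
Definition frame_map (ys : {ffun 'I_k -> Zf} * Zf) (z : Zf) : {ffun 'I_(k + 2) -> Zf} :=
  [ffun i => \sum_j P j i *: (ys.1 j : Z) + q i *: (ys.2 : Z) + (z : Z) : Zf].

Lemma frame_comb (c : 'I_(k + 2) -> F) ys z :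
  \sum_i c i *: (frame_map ys z i : Z) =
  \sum_j (\sum_i P j i * c i) *: (ys.1 j : Z) + (\sum_i q i * c i) *: (ys.2 : Z)
    + (\sum_i c i) *: (z : Z).
Proof.
under [X in X + _ + _]eq_bigr => j _ do rewrite scaler_suml.
rewrite exchange_big !scaler_suml -!big_split; apply: eq_bigr => i _ /=.
rewrite ffunE !scalerDr scaler_sumr scalerA [q i * _]mulrC; congr (_ + _ + _).
by apply: eq_bigr => j _; rewrite scalerA mulrC.
Qed.

Lemma frame_P j ys z : \sum_i P j i *: (frame_map ys z i : Z) = ys.1 j.
Proof.
rewrite frame_comb P1 scale0r addr0; under [X in _ + X *: _]eq_bigr => i _ do rewrite mulrC.
rewrite Pq scale0r addr0 (bigD1 j) //= PP eqxx scale1r big1 ?addr0 // => i ij.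
by rewrite PP (negPf ij) scale0r.
Qed.

Lemma frame_q ys z : \sum_i q i *: (frame_map ys z i : Z) = t *: (ys.2 : Z).
Proof.
rewrite frame_comb q1 scale0r addr0 qq big1 ?add0r // => j _.
by rewrite Pq scale0r.
Qed.

Lemma frame_1 ys z : \sum_i (frame_map ys z i : Z) = t *: (z : Z).
Proof.
under eq_bigr => i _ do rewrite -[frame_map _ _ _ : Z]scale1r.
rewrite frame_comb sumr_const card_ord.
under [X in _ + X *: _ + _]eq_bigr => i _ do rewrite mulr1.
rewrite q1 scale0r addr0 big1 ?add0r // => j _.
by under eq_bigr => i _ do rewrite mulr1; rewrite P1 scale0r.
Qed.

Lemma frame_bij : bijective (fun yz : ({ffun 'I_k -> Zf} * Zf) * Zf => frame_map yz.1 yz.2).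
Proof.
apply: inj_card_bij => [[[y s] z] [[y' s'] z'] /= e|]; last first.
  by rewrite !card_prod !card_ffun !card_ord expnD expnS expn1 mulnA.
congr (_, _, _).
- by apply/ffunP => j; have := frame_P j (y, s) z; rewrite e frame_P.
- by apply: (scalerI t0); have := frame_q (y, s) z; rewrite e frame_q.
- by apply: (scalerI t0); have := frame_1 (y, s) z; rewrite e frame_1.
Qed.

(** Contracting one argument first with each basis vector leaves only the
    coordinates given by the orthogonality relations. *)
Lemma frame_form A ys z ys' z' :
  \sum_i 1 * lbil br A (frame_map ys z i) (frame_map ys' z' i) =
  \sum_j 1 * lbil br A (ys.1 j) (ys'.1 j) + t * lbil br A ys.2 ys'.2 + t * lbil br A z z'.
Proof.
have brsum (I : finType) (c : I -> F) (f : I -> Z) x :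
    br (\sum_i c i *: f i) x = \sum_i c i * br (f i) x.
  by rewrite (big_morph _ (fun a b => brD pbr a b x) (br0 pbr x));
     apply: eq_bigr => i _; rewrite (brZ pbr).
have lsum (c : 'I_(k + 2) -> F) (x : Z) : \sum_i c i * lbil br A (frame_map ys z i) x =
    lbil br A (\sum_i c i *: (frame_map ys z i : Z)) x.
  rewrite /lbil linear_sum (big_morph _ (brDr pbr x) (br0r pbr x)).
  by apply: eq_bigr => i _; rewrite linearZ (brZr pbr).
transitivity (\sum_j \sum_i P j i * lbil br A (frame_map ys z i) (ys'.1 j) +
    \sum_i q i * lbil br A (frame_map ys z i) ys'.2 +
    \sum_i 1 * lbil br A (frame_map ys z i) z').
  rewrite exchange_big -!big_split; apply: eq_bigr => i _ /=.
  rewrite mul1r [frame_map ys' z' i]ffunE {1}/lbil !(brD pbr) (brZ pbr) brsum.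
  by rewrite mul1r.
rewrite !lsum frame_q; congr (_ + _ + _).
- by apply: eq_bigr => j _; rewrite lsum frame_P mul1r.
- by rewrite /lbil linearZ (brZr pbr).
- under eq_bigr => i _ do rewrite scale1r.
  by rewrite frame_1 /lbil linearZ (brZr pbr).
Qed.

Lemma frame_act (C : 'End(Z)) ys z :
  [ffun i => C (frame_map ys z i) : Zf] =
  frame_map ([ffun j => C (ys.1 j) : Zf], C ys.2 : Zf) (C z).
Proof.
apply/ffunP => i; rewrite !ffunE !linearD linear_sum linearZ; congr (_ + _ + _).
by apply: eq_bigr => j _; rewrite linearZ ffunE.
Qed.

Lemma frame_weyl l x y ys z :
  tpow_op (k + 2) (weyl R pF br 1 (l, (x, y))) (delta R (frame_map ys z)) =
  chi R pF (t * (2^-1 * br y x + br z x + l)) *: delta R (frame_map ys (z + y)).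
Proof.
rewrite tpow_op_delta (_ : frame_map ys (z + y) = [ffun i => frame_map ys z i + y]); last first.
  by apply/ffunP => i; rewrite !ffunE addrA.
rewrite delta_ffun [RHS](_ : _ = tpow_fun (fun i =>
   chi R pF (2^-1 * br y x + br (frame_map ys z i) x + l) *:
   delta R (frame_map ys z i + (y : Zf)))).
  by apply: tpow_fun_eq => i; rewrite op_ofE omegaE mul1r.
rewrite tpow_funZ -chi_big; congr (chi _ _ _ *: _); last first.
  by apply: tpow_fun_eq => i; rewrite ffunE.
rewrite !big_split /= !sumr_const card_ord -(big_morph _ (fun a b => brD pbr a b x) (br0 pbr x)).
by rewrite frame_1 (brZ pbr) !mulrDr !(mulr_natl _ (k + 2)).
Qed.

Theorem tpow_correspondence (mu mu_t : 'End(V) -> 'End(L2 R Zf)) :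
  is_oscillator pF br 1 mu -> is_oscillator pF br t mu_t ->
  let rho1 := fun S => tens_op (tpow_op k (mu S)) (mu_t S) in
  let rho2 := fun g => tpow_op (k + 2) (clifford pF br 1 mu g) in
  correspondence (invariant_sub (Sp br) rho1) (rep_iso (Sp br) rho1)
                 (invariant_sub (Jacobi br) rho2) (rep_iso (Jacobi br) rho2).
Proof.
move=> /oscillator_weil w /oscillator_weil wt rho1 rho2.
apply: (@weil_correspondence R F p pF Y Z br pbr _ _ ([ffun=> 0], 0) frame_map t t0 frame_bij
  _ _ _ _ _ _ (weil_tens (weil_tpow k w) wt) (weil_tpow (k + 2) w) _ _
  (fun g => tpow_op (k + 2) (weyl R pF br 1 g))).
- by move=> A ys z ys' z' _; apply: frame_form.
- by move=> C C' _ _ ys z; apply: frame_act.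
- exact: frame_weyl.
- by move=> g; rewrite -tpow_op_comp.
Qed.

End TensorPowers.

(** * The correspondences *)

Theorem proposition4p2 (R : realType) (F : finFieldType) (p : nat)
    (pF : p \in [pchar F]) (p_odd : odd p) (X : vectType F) :
  (forall (U : vectType F) (beta : {symmetric U}) (u : U),
    nondegenerate beta -> beta u u != 0 ->
    let U' := subvs_of (orthov beta <[u]>) in
    let beta' := fun a b : U' => beta (vsval a) (vsval b) in
    forall (muU : 'End(('Hom(dualv X, U) * 'Hom(X, U))%type) ->
                  'End(L2 R (finvect_type 'Hom(X, U))))
           (muU' : 'End(('Hom(dualv X, U') * 'Hom(X, U'))%type) ->
                   'End(L2 R (finvect_type 'Hom(X, U')))),
      is_oscillator pF (tens_br beta) 1 muU ->
      is_oscillator pF (tens_br beta') 1 muU' ->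
      let rho1 := fun S : 'End((X * dualv X)%type) => muU' (id_tens U' S) in
      let rho2 := clifford_u pF beta u muU in
      let D1 := Sp (@ev F X) in
      let D2 := Jacobi (@ev F X) in
      correspondence (invariant_sub D1 rho1) (rep_iso D1 rho1)
                     (invariant_sub D2 rho2) (rep_iso D2 rho2))
  /\
  (forall t : nat, (2 <= t)%N -> ~~ (p %| t)%N ->
    forall mu mu_t : 'End((X * dualv X)%type) ->
                     'End(L2 R (finvect_type (dualv X))),
      is_oscillator pF (@ev F X) 1 mu ->
      is_oscillator pF (@ev F X) t%:R mu_t ->
      let rho1 := fun S => tens_op (tpow_op (t - 2) (mu S)) (mu_t S) in
      let rho2 := fun g => tpow_op t (clifford pF (@ev F X) 1 mu g) in
      let D1 := Sp (@ev F X) in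
      let D2 := Jacobi (@ev F X) in
      correspondence (irreducible_sub D1 rho1) (rep_iso D1 rho1)
                     (irreducible_sub D2 rho2) (rep_iso D2 rho2)).
Proof.
have p_pr := prime_p pF.
have two0 : 2%:R != 0 :> F.
  rewrite -(dvdn_pcharf pF) dvdn_prime2 //.
  by apply: contraL p_odd => /eqP ->.
split=> [U beta u _ u0 U' beta' muU muU' osc osc'|t t2 pt mu mu_t].
  exact: orthov_correspondence.
move: (t - 2)%N (subnK t2) pt => k <- {t t2} pt osc osct.
have t0 : (k + 2)%:R != 0 :> F by rewrite -(dvdn_pcharf pF).
have [P [q [PP Pq qq P1 q1]]] := orthogonal_frame two0 t0.
apply: irreducible_correspondence.
exact: (tpow_correspondence (ev_perfect X) t0 PP Pq qq P1 q1 osc osct).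
Qed.
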